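(* Let $\kappa$ denote the supremum of $\lim_{n\to\infty}\lVert P^n(x,\cdot)-P^n(y,\cdot)\rVert_{\mathrm{TV}}$ taken over all transition matrices $P$ of (time-homogeneous, discrete-time) Markov chains on finite state spaces and all pairs of states $x,y$ such that two copies of the chain with transition matrix $P$, one started in $x$ and the other started in $y$, can be coupled to meet almost surely in finite time. Then $\kappa=\tfrac12$.
   Context: For a Markov chain on $S$ with transition matrix $P$, $P^n(x,\cdot)$ denotes the distribution of $X_n$ given $X_0=x$. For probability distributions $\mu,\nu$ on a countable set $S$, $\lVert\mu-\nu\rVert_{\mathrm{TV}}:=\sup_{A\subseteq S}|\mu(A)-\nu(A)|$. The sequence $\lVert P^n(x,\cdot)-P^n(y,\cdot)\rVert_{\mathrm{TV}}$ is non-increasing in $n$, so the limit exists. A coupling of two copies of the chain started in $x$ and $y$ is a process $((X_n,Y_n))_{n\in\mathbb{N}_0}$ on $S\times S$ (defined on some probability space) such that $(X_n)_{n\in\mathbb{N}_0}$ and $(Y_n)_{n\in\mathbb{N}_0}$ are each Markov chains on $S$ (with respect to their own natural filtrations) with transition matrix $P$, and $X_0=x$, $Y_0=y$. The joint process is not required to be a Markov chain. The first meeting time is $\tau:=\inf\{n\ge 0: X_n=Y_n\}$. The copies ''can be coupled to meet almost surely in finite time'' if there is such a coupling with $\mathbb{P}(\tau<\infty)=1$. *)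

(* Defs.v *)
From mathcomp Require Import all_boot all_order all_algebra.
From mathcomp Require Import all_classical all_reals all_analysis.
Import Order.TTheory GRing.Theory Num.Theory.
Import numFieldNormedType.Exports.

Set Implicit Arguments.
Unset Strict Implicit.
Unset Printing Implicit Defensive.

Local Open Scope classical_set_scope.
Local Open Scope ring_scope.

Definition transition_matrix (R : realType) (S : finType) (P : S -> S -> R) :
    Prop :=
  (forall s t, 0 <= P s t) /\ (forall s, \sum_(t : S) P s t = 1).

(* Entries of the matrix power P^n; the function [step_law P n x] is the
   probability mass function of P^n(x, .). *)
Fixpoint step_law (R : realType) (S : finType) (P : S -> S -> R) (n : nat)
    (x y : S) : R :=
  if n is m.+1 then \sum_(z : S) P x z * step_law P m z y else (x == y)%:R.

(* Distributions on a finite set are represented by their mass functions. *)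
Definition tv_dist (R : realType) (S : finType) (mu nu : S -> R) : R :=
  sup [set `|\sum_(s in A) mu s - \sum_(s in A) nu s| | A in [set: {set S}]].

(* The state space carries the discrete sigma-algebra. *)
Definition natural_filtration (Omega : Type) (S : finType)
    (X : nat -> Omega -> S) (n : nat) : set (set Omega) :=
  <<s \bigcup_(k in `I_n.+1) preimage_set_system setT (X k) [set: set S] >>.

(* The integral identity is the defining property of the conditional
   probability Pr(X_{n+1} = t | F_n) = P(X_n, t) a.s., where F_n is the natural
   filtration of X; P(X_n, t) is F_n-measurable since S is discrete. *)
Definition markov_chain (R : realType) (S : finType) (P : S -> S -> R)
    (d : measure_display) (Omega : measurableType d) (Pr : probability Omega R)
    (X : nat -> Omega -> S) : Prop :=
  (forall n (B : set S), measurable (X n @^-1` B)) /\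
  (forall n (t : S) (A : set Omega), natural_filtration X n A ->
     (Pr (A `&` X n.+1 @^-1` [set t]) =
      \int[Pr]_(w in A) (P (X n w) t)%:E)%E).

Definition coupling (R : realType) (S : finType) (P : S -> S -> R) (x y : S)
    (d : measure_display) (Omega : measurableType d) (Pr : probability Omega R)
    (X Y : nat -> Omega -> S) : Prop :=
  [/\ markov_chain P Pr X, markov_chain P Pr Y,
      {ae Pr, forall w, X 0%N w = x} & {ae Pr, forall w, Y 0%N w = y}].

(* The infimum is +oo when the two paths never meet. *)
Definition meeting_time (R : realType) (Omega : Type) (S : finType)
    (X Y : nat -> Omega -> S) (w : Omega) : \bar R :=
  ereal_inf [set (n%:R)%:E | n in [set n : nat | X n w = Y n w]].

Definition can_be_coupled_to_meet (R : realType) (S : finType)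
    (P : S -> S -> R) (x y : S) : Prop :=
  exists (d : measure_display) (Omega : measurableType d)
         (Pr : probability Omega R) (X Y : nat -> Omega -> S),
    coupling P x y Pr X Y /\
    Pr [set w | (meeting_time R X Y w < +oo)%E] = 1%E.

Definition limiting_tv_dist (R : realType) (S : finType) (P : S -> S -> R)
    (x y : S) : R :=
  lim ((fun n => tv_dist (step_law P n x) (step_law P n y)) @ \oo).

(* [sup] is 0 by convention on sets without a supremum; here the set is nonempty
   (take x = y) and bounded by 1. *)
Definition kappa (R : realType) : R :=
  sup [set v : R | exists (S : finType) (P : S -> S -> R) (x y : S),
    [/\ transition_matrix P, can_be_coupled_to_meet P x y &
        v = limiting_tv_dist P x y]].

(* Main.v *)
(* Upper bound. Fix n and a set A. The processes k |-> P^(n-k)(X_k, ~A) and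
   k |-> P^(n-k)(Y_k, A), k <= n, are martingales started at P^n(x, ~A) and
   P^n(y, A). When X_k = Y_k = s, one of P^(n-k)(s, ~A), P^(n-k)(s, A) is at
   least 1/2, so Doob's maximal inequality gives
   Pr(tau <= n) <= 2 (P^n(x, ~A) + P^n(y, A)); let n tend to infinity.

   Lower bound. Let K = 4k and m = k + 1. Simple random walk on {0, ..., K},
   absorbed at 0 and K, is started at K - m by one copy and at m by the other,
   after a waiting time that is uniform on a long interval. The probabilities
   of ending at K differ by 1 - 2m/K, which tends to 1/2. Let I be the minimum
   of a path of the first walk that ends at K and J the maximum of a path of the
   second walk that ends at 0. The masses (m / (K - t)) (t / K) of {I <= t} and
   (m / (t + 1)) ((K - t - 1) / K) of {J > t} add up to about 2m/K > 1 - 2m/K for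
   every t, so paths of mass 1 - 2m/K can be matched in such a way that I <= J.
   Matched paths share a level, and as a uniform waiting time is almost
   invariant under bounded shifts, the waiting times can be coupled so that
   both paths are at that level simultaneously. The samples left over are
   paired so that the two walks end at the same point. *)
Require Import Defs.
From HB Require Import structures.
From mathcomp Require Import all_boot all_order all_algebra.
From mathcomp Require Import all_classical all_reals all_analysis.
From mathcomp Require Import measurable_realfun ring lra zify.
Import Order.TTheory GRing.Theory Num.Theory.
Import numFieldNormedType.Exports.

Set Implicit Arguments.
Unset Strict Implicit.
Unset Printing Implicit Defensive.

Local Open Scope classical_set_scope.
Local Open Scope ring_scope.

(** * The upper bound *)

Section MarkovChain.
Variables (R : realType) (S : finType) (P : S -> S -> R).
Hypothesis P_tm : transition_matrix P.
Variables (d : measure_display) (Omega : measurableType d).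
Variables (Pr : probability Omega R) (X : nat -> Omega -> S).

Local Notation p A := (fine (Pr A)).

Lemma fine_probE (A : set Omega) : measurable A -> Pr A = (p A)%:E.
Proof. by move=> mA; rewrite fineK// fin_num_measure. Qed.

Lemma fine_prob_ge0 (A : set Omega) : 0 <= p A.
Proof. by rewrite fine_ge0. Qed.

Lemma integral_finite_valued (A : set Omega) (h : Omega -> S) (g : S -> R) :
  measurable A -> (forall B : set S, measurable (h @^-1` B)) ->
  (forall s, 0 <= g s) ->
  (\int[Pr]_(w in A) (g (h w))%:E)%E =
  (\sum_s g s * p (A `&` h @^-1` [set s]))%:E.
Proof.
move=> mA mh g0.
have mhs s : measurable (h @^-1` [set s]) by [].
rewrite (eq_integral
  (fun w => \sum_(s <- enum S) (g s * \1_(h @^-1` [set s]) w)%:E)%E); last first.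
  move=> w _; rewrite big_enum/= (bigD1 (h w))//= big1 ?adde0.
    by rewrite indicE mem_set ?mulr1.
  move=> s /eqP sh; rewrite indicE memNset ?mulr0//=.
  by move=> hs; apply: sh.
rewrite ge0_integral_sum//; last 2 first.
- move=> s; apply/measurable_EFinP; apply: measurable_funM => //.
- by move=> s w _; rewrite lee_fin mulr_ge0// indicE.
rewrite -sumEFin big_enum/=; apply: eq_bigr => s _.
under eq_integral do rewrite EFinM.
rewrite ge0_integralZl_EFin//.
- by rewrite integral_indic// EFinM setIC -fine_probE//; exact: measurableI.
- exact/measurable_EFinP.
Qed.

Lemma fine_prob_partition (A : set Omega) (h : Omega -> S) :
  measurable A -> (forall B : set S, measurable (h @^-1` B)) ->
  p A = \sum_s p (A `&` h @^-1` [set s]).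
Proof.
move=> mA mh; apply: EFin_inj; rewrite -fine_probE//.
have /= := @integral_finite_valued _ _ (fun=> 1) mA mh (fun=> ler01).
rewrite integral_cst// mul1e => ->.
by congr (_%:E); apply: eq_bigr => s _; rewrite mul1r.
Qed.

Hypothesis XM : markov_chain P Pr X.

Lemma natural_filtration_measurable n :
  natural_filtration X n `<=` measurable.
Proof.
apply: smallest_sub; first exact: sigma_algebra_measurable.
move=> A [k _ [B _ <-]]; rewrite setTI.
exact: XM.1.
Qed.

(** The defining identity for single states t, summed with weights g t; it reads E[1_A g(X_{n+1})] =
    E[1_A (P g)(X_n)]. *)
Lemma markov_step n (A : set Omega) (g : S -> R) : natural_filtration X n A ->
  \sum_t g t * p (A `&` X n.+1 @^-1` [set t]) =
  \sum_s (\sum_t P s t * g t) * p (A `&` X n @^-1` [set s]).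
Proof.
move=> FA; have mA := natural_filtration_measurable FA.
under eq_bigr => t _.
  rewrite (_ : p _ = \sum_s P s t * p (A `&` X n @^-1` [set s])).
    over.
  have mX := XM.1; have P0 s : 0 <= P s t by exact: P_tm.1.
  by rewrite (XM.2 n t A FA) (integral_finite_valued mA (mX n) P0).
rewrite /=; under eq_bigr do rewrite mulr_sumr.
rewrite exchange_big/=; apply: eq_bigr => s _.
by rewrite mulr_suml; apply: eq_bigr => t _; rewrite mulrCA mulrA mulrC mulrA.
Qed.

Lemma natural_filtrationT n : natural_filtration X n setT.
Proof.
rewrite -[X in natural_filtration _ _ X](setD0 setT).
by apply: sigma_algebraCD; exact: sigma_algebra0.
Qed.

Definition staying_below (U : nat -> S -> R) (c : R) (k : nat) : set Omega :=
  [set w | forall j, (j < k)%N -> U j (X j w) < c].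

Lemma staying_belowS_filtration U c k :
  natural_filtration X k (staying_below U c k.+1).
Proof.
(* The condition j <= k sits inside B j, so that the union runs over all j, with empty terms beyond
   k. *)
pose B j : set S := [set s | (j <= k)%N /\ c <= U j s].
rewrite (_ : staying_below _ _ _ = setT `\` \bigcup_j (X j @^-1` B j)).
  rewrite /natural_filtration; apply: sigma_algebraCD.
  apply: sigma_algebra_bigcup => j.
  have [jk|jk] := leqP j k; last first.
    rewrite (_ : _ @^-1` _ = set0); first exact: sigma_algebra0.
    by rewrite -subset0 => w [/=]; rewrite leqNgt jk.
  apply: sub_sigma_algebra; exists j; first by rewrite /= ltnS.
  by exists (B j) => //; rewrite setTI.
rewrite setTD; apply/seteqP; split => w.
  move=> Ew [j _ [/= jk]]; rewrite leNgt => /negP; apply.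
  exact: Ew.
move=> nB j jk; rewrite ltNge; apply/negP => cU; apply: nB.
by exists j => //; split.
Qed.

Lemma staying_below_measurable U c k : measurable (staying_below U c k).
Proof.
case: k => [|k]; last first.
  exact: natural_filtration_measurable (@staying_belowS_filtration _ _ _).
by rewrite (_ : staying_below _ _ _ = setT)// -subTset => w _ j.
Qed.

Lemma staying_belowS U c k s :
  p (staying_below U c k.+1 `&` X k @^-1` [set s]) =
  if U k s < c then p (staying_below U c k `&` X k @^-1` [set s]) else 0.
Proof.
case: ifPn => [Us|Us].
  congr (p _); apply/seteqP; split => w [Ew Xw]; split => // j.
    by move=> jk; apply: Ew; exact: ltnW.
  rewrite ltnS leq_eqVlt => /predU1P[->|]; last exact: Ew.
  by rewrite Xw.
rewrite (_ : _ `&` _ = set0) ?measure0// -subset0 => w [Ew Xw].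
by move/negP: Us; apply; rewrite -[X in U k X]Xw; exact: Ew.
Qed.

(* Doob's maximal inequality for the martingale [U k (X k)], k <= n. *)
Lemma maximal_inequality (U : nat -> S -> R) (c : R) n :
  (forall k s, (k < n)%N -> U k s = \sum_t P s t * U k.+1 t) ->
  (forall k s, (k <= n)%N -> 0 <= U k s) ->
  c * (1 - p (staying_below U c n.+1)) <=
  \sum_s U 0%N s * p (X 0%N @^-1` [set s]).
Proof.
move=> Uharm U0.
have mX := XM.1.
pose E := staying_below U c.
(* Expectation at time k of the process in which the martingale is replaced by c once it has reached
   c before time k. It starts at E[U 0 (X 0)] and never increases. *)
pose psi k := c * (1 - p (E k)) + \sum_s U k s * p (E k `&` X k @^-1` [set s]).
(* At a fixed time, states with U k s >= c trade U k s for c, which can only lower the sum; the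
   transition to time k + 1 then preserves it. *)
have half k : (k <= n)%N -> c * (1 - p (E k.+1)) +
    \sum_s U k s * p (E k.+1 `&` X k @^-1` [set s]) <= psi k.
  move=> kn; rewrite /psi.
  have mE j : measurable (E j) by exact: staying_below_measurable.
  rewrite (@fine_prob_partition (E k) (X k))//.
  rewrite (@fine_prob_partition (E k.+1) (X k))//.
  rewrite !mulrBr mulr1 -!addrA lerD2l -!mulNr !mulr_sumr -!big_split/=.
  apply: ler_sum => s _; rewrite /E staying_belowS.
  case: ltP => // cU; rewrite !mulr0 addr0 mulNr addrC subr_ge0.
  by rewrite ler_wpM2r// fine_prob_ge0.
have dec k : (k < n)%N -> psi k.+1 <= psi k.
  move=> kn; apply: le_trans (half k (ltnW kn)).
  rewrite /psi markov_step; last exact: staying_belowS_filtration.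
  rewrite lerD2l; apply: ler_sum => s _.
  by rewrite -Uharm.
have psi_le k : (k <= n)%N -> psi k <= psi 0%N.
  elim: k => // k ih kn; exact: le_trans (dec k kn) (ih (ltnW kn)).
have E0 : E 0%N = setT by rewrite -subTset => w _ j.
have -> : \sum_s U 0%N s * p (X 0%N @^-1` [set s]) = psi 0%N.
  rewrite /psi E0 probability_setT subrr mulr0 add0r.
  by under [in RHS]eq_bigr do rewrite setTI.
apply: le_trans (psi_le n (leqnn n)); apply: le_trans (half n (leqnn n)).
rewrite lerDl; apply: sumr_ge0 => s _.
by rewrite mulr_ge0 ?U0// fine_prob_ge0.
Qed.

Variable x : S.
Hypothesis X0 : {ae Pr, forall w, X 0%N w = x}.

Lemma initial_law s : p (X 0%N @^-1` [set s]) = (x == s)%:R.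
Proof.
have mX := XM.1.
have h1 : Pr (X 0%N @^-1` [set x]) = 1%E.
  have := X0; rewrite /almost_everywhere /= => /negligibleP h.
  have mC : measurable (~` [set w | X 0%N w = x]).
    by apply: measurableC; exact: (mX 0%N [set x]).
  have h0 : Pr (~` [set w | X 0%N w = x]) = 0%E by exact: h.
  by have := probability_setC Pr mC; rewrite setCK h0 sube0.
have [<-|xs] := eqVneq x s; first by rewrite h1.
apply/eqP; rewrite eq_le fine_prob_ge0 andbT -lee_fin -fine_probE; last first.
  exact: (mX 0%N [set s]).
apply: le_trans (_ : Pr (~` (X 0%N @^-1` [set x])) <= _)%E.
  apply: le_measure; rewrite ?inE.
  - exact: (mX 0%N [set s]).
  - by apply: measurableC; exact: (mX 0%N [set x]).
  - by move=> w /= -> /esym; exact/eqP.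
by rewrite probability_setC ?h1 ?subee//; exact: (mX 0%N [set x]).
Qed.

End MarkovChain.

(** * Powers of the transition matrix and their martingales *)

Section StepLaw.
Variables (R : realType) (S : finType) (P : S -> S -> R).
Hypothesis P_tm : transition_matrix P.

Lemma step_law_ge0 n x y : 0 <= step_law P n x y.
Proof.
elim: n x => [|n ih] x /=; first exact: ler0n.
by apply: sumr_ge0 => z _; rewrite mulr_ge0// P_tm.1.
Qed.

Lemma step_law_sum n x : \sum_y step_law P n x y = 1.
Proof.
elim: n x => [|n ih] x /=.
  rewrite (bigD1 x)//= eqxx big1 ?addr0// => y.
  by rewrite eq_sym => /negPf ->.
rewrite exchange_big/= -[RHS](P_tm.2 x); apply: eq_bigr => z _.
by rewrite -mulr_sumr ih mulr1.
Qed.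

Lemma step_law_sum_set n x (A : {set S}) :
  \sum_(s in A) step_law P n x s + \sum_(s in ~: A) step_law P n x s = 1.
Proof.
rewrite -(step_law_sum n x) [RHS](bigID (mem A))/=; congr (_ + _).
by apply: eq_bigl => s; rewrite inE.
Qed.

Lemma step_law_sum_ge0 n x (A : {set S}) : 0 <= \sum_(s in A) step_law P n x s.
Proof. by apply: sumr_ge0 => s _; exact: step_law_ge0. Qed.

Lemma step_law_sumS n x (A : {set S}) :
  \sum_(s in A) step_law P n.+1 x s =
  \sum_t P x t * \sum_(s in A) step_law P n t s.
Proof. by rewrite exchange_big/=; apply: eq_bigr => t _; rewrite mulr_sumr. Qed.

Section Chain.
Variables (d : measure_display) (Omega : measurableType d).
Variables (Pr : probability Omega R) (X : nat -> Omega -> S) (x : S).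
Hypothesis XM : markov_chain P Pr X.
Hypothesis X0 : {ae Pr, forall w, X 0%N w = x}.

Lemma sum_initial_law (g : S -> R) :
  \sum_s g s * fine (Pr (X 0%N @^-1` [set s])) = g x.
Proof.
under eq_bigr do rewrite (initial_law XM X0).
rewrite (bigD1 x)//= eqxx mulr1 big1 ?addr0// => s.
by rewrite eq_sym => /negPf ->; rewrite mulr0.
Qed.

(** The first-step recursion makes P^(n-k)(s, A) harmonic in (k, s), and its initial value is P^n(x,
    A). *)
Lemma maximal_inequality_step_law n (A : {set S}) (c : R) :
  c * (1 - fine (Pr (staying_below X
    (fun k s => \sum_(a in A) step_law P (n - k) s a) c n.+1))) <=
  \sum_(a in A) step_law P n x a.
Proof.
have h1 : forall k s, (k < n)%N -> \sum_(a in A) step_law P (n - k) s a =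
    \sum_t P s t * \sum_(a in A) step_law P (n - k.+1) t a.
  by move=> k s kn; rewrite -step_law_sumS subnSK.
have h2 : forall k s, (k <= n)%N -> 0 <= \sum_(a in A) step_law P (n - k) s a.
  by move=> k s _; exact: step_law_sum_ge0.
have := maximal_inequality P_tm XM c h1 h2.
by rewrite sum_initial_law subn0.
Qed.

End Chain.
End StepLaw.

(** * The probability of meeting by time n *)

Section Meeting.
Variables (R : realType) (S : finType) (P : S -> S -> R).
Hypothesis P_tm : transition_matrix P.

Definition met_by (Omega : Type) (X Y : nat -> Omega -> S) (n : nat) :
  set Omega := [set w | exists2 k, (k <= n)%N & X k w = Y k w].

Lemma meeting_time_finite (Omega : Type) (X Y : nat -> Omega -> S) :
  [set w | (meeting_time R X Y w < +oo)%E] = \bigcup_n met_by X Y n.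
Proof.
apply/seteqP; split => w.
  move=> /ereal_inf_lt[_ [n XYn <-] _]; by exists n => //; exists n.
move=> [n _ [k kn XYk]] /=.
apply: (@le_lt_trans _ _ (k%:R)%:E); last exact: ltry.
by apply: ereal_inf_lbound; exists k.
Qed.

Variables (x y : S) (d : measure_display) (Omega : measurableType d).
Variables (Pr : probability Omega R) (X Y : nat -> Omega -> S).
Hypothesis XYc : coupling P x y Pr X Y.

Lemma met_by_measurable n : measurable (met_by X Y n).
Proof.
case: XYc => XM YM _ _.
rewrite (_ : met_by X Y n = \bigcup_k \bigcup_(s in [set: S])
    ((X k @^-1` [set s] `&` Y k @^-1` [set s]) `&` [set w | (k <= n)%N])).
  apply: bigcup_measurable => k _; apply: fin_bigcup_measurable.
    exact: finite_finset.
  move=> s _; apply: measurableI; first apply: measurableI.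
  - exact: (XM.1 k [set s]).
  - exact: (YM.1 k [set s]).
  - case: (k <= n)%N.
      by rewrite (_ : [set _ | _] = setT)//; apply/seteqP; split.
    by rewrite (_ : [set _ | _] = set0)//; apply/seteqP; split.
apply/seteqP; split => w.
  by move=> [k kn XYk]; exists k => //; exists (X k w) => //; split.
by move=> [k _ [s _ [[/= Xs Ys] kn]]]; exists k => //; rewrite Xs Ys.
Qed.

(* At a meeting state s one of P^(n-k)(s, A), P^(n-k)(s, ~A) is >= 1/2. *)
Lemma met_by_le n (A : {set S}) :
  fine (Pr (met_by X Y n)) <=
  2 * (\sum_(s in ~: A) step_law P n x s + \sum_(s in A) step_law P n y s).
Proof.
case: XYc => XM YM X0 Y0.
have := maximal_inequality_step_law P_tm XM X0 n (~: A) 2^-1.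
have := maximal_inequality_step_law P_tm YM Y0 n A 2^-1.
set UX := (fun k s => \sum_(a in ~: A) _).
set UY := (fun k s => \sum_(a in A) _).
set EX := staying_below X _ _ _; set EY := staying_below Y _ _ _.
have mEX : measurable EX by exact: (staying_below_measurable XM).
have mEY : measurable EY by exact: (staying_below_measurable YM).
suff : fine (Pr (met_by X Y n)) <=
    (1 - fine (Pr EX)) + (1 - fine (Pr EY)) by lra.
have sub : met_by X Y n `<=` ~` EX `|` ~` EY.
  move=> w [k kn XYk]; apply: contrapT => /not_orP[/contrapT EXw /contrapT EYw].
  have := EXw k; have := EYw k; rewrite !ltnS kn => /(_ isT) + /(_ isT).
  rewrite XYk /UX /UY.
  have := step_law_sum_set P_tm (n - k) (Y k w) A; lra.
have -> : 1 - fine (Pr EX) = fine (Pr (~` EX)).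
  by rewrite probability_setC// fineB// fin_num_measure.
have -> : 1 - fine (Pr EY) = fine (Pr (~` EY)).
  by rewrite probability_setC// fineB// fin_num_measure.
have mU : measurable (~` EX `|` ~` EY).
  by apply: measurableU; exact: measurableC.
rewrite -lee_fin EFinD -!fine_probE; [|exact: measurableC..|].
  apply: le_trans (measureU2 _ _ _); [|exact: measurableC..].
  by apply: le_measure sub; rewrite inE//; exact: met_by_measurable.
exact: met_by_measurable.
Qed.

End Meeting.

(** * The limiting distance of a successful coupling *)

Section UpperBound.
Variables (R : realType) (S : finType) (P : S -> S -> R) (x y : S).
Hypothesis P_tm : transition_matrix P.

Lemma tv_dist_le (mu nu : S -> R) (c : R) :
  (forall A : {set S}, `|\sum_(s in A) mu s - \sum_(s in A) nu s| <= c) ->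
  tv_dist mu nu <= c.
Proof.
move=> h; apply: ge_sup; last by move=> _ [A _ <-].
exists `|\sum_(s in finset.set0) mu s - \sum_(s in finset.set0) nu s|.
by exists finset.set0.
Qed.

Lemma le_tv_dist (mu nu : S -> R) (A : {set S}) :
  `|\sum_(s in A) mu s - \sum_(s in A) nu s| <= tv_dist mu nu.
Proof.
apply: ub_le_sup; last by exists A.
exists (\sum_(s : S) `|mu s - nu s|) => _ [B _ <-].
rewrite -sumrB; apply: le_trans (ler_norm_sum _ _ _) _.
rewrite big_mkcond/=; apply: ler_sum => s _.
by case: ifP => // _; exact: normr_ge0.
Qed.

(** The distance at time n is at most 1 - Pr(tau <= n) / 2, and Pr(tau <= n) increases to 1. *)
Lemma limiting_tv_dist_le : can_be_coupled_to_meet P x y ->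
  limiting_tv_dist P x y <= 1 / 2.
Proof.
move=> [d [Om [Pr [X [Y [XYc meet]]]]]].
rewrite meeting_time_finite in meet.
pose u n := tv_dist (step_law P n x) (step_law P n y).
have u_le n : u n <= 1 - fine (Pr (met_by X Y n)) / 2.
  apply: tv_dist_le => A.
  (* A and its complement bound the two signs of the difference. *)
  have := met_by_le P_tm XYc n A; have := met_by_le P_tm XYc n (~: A).
  have := step_law_sum_set P_tm n x A; have := step_law_sum_set P_tm n y A.
  by rewrite finset.setCK ler_norml => *; apply/andP; split; lra.
have cvg_met : (fun n => 1 - fine (Pr (met_by X Y n)) / 2) @ \oo --> (1 / 2 : R).
  rewrite (_ : 1 / 2 = 1 - fine 1%E / 2 :> R); last by rewrite /=; lra.
  apply: cvgB; first exact: cvg_cst.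
  apply: cvgMl; apply: fine_cvg => /=; rewrite -meet.
  apply: nondecreasing_cvg_mu.
  - by move=> i; exact: (met_by_measurable XYc).
  - by apply: bigcup_measurable => i _; exact: (met_by_measurable XYc).
  - move=> m n mn; apply/subsetPset => w [k km XYk].
    by exists k => //; exact: leq_trans km mn.
rewrite /limiting_tv_dist -/u.
have [cu|ncu] := pselect (cvg (u @ \oo)).
  rewrite -(cvg_lim _ cvg_met)//; apply: ler_lim => //.
  - exact: cvgP cvg_met.
  - by apply: nearW => n; exact: u_le.
(* Without convergence, [lim] takes the default value [point], which is 0. *)
rewrite (dvgP ncu).
rewrite (_ : point = 0 :> R)//; lra.
Qed.

End UpperBound.

(** * Gambler's ruin *)

Section CoinWords.
Variable R : realType.

(** Q accepts words of any length, so that conditioning on the first toss yields a predicate of the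
    same type. *)
Definition coin_prob N (Q : pred (seq bool)) : R :=
  #|[pred w : N.-tuple bool | Q w]|%:R / 2 ^+ N.

Lemma card_tupleS N (Q : pred (seq bool)) :
  #|[pred w : N.+1.-tuple bool | Q w]| =
  (#|[pred w : N.-tuple bool | Q (true :: w)]| +
   #|[pred w : N.-tuple bool | Q (false :: w)]|)%N.
Proof.
pose h (p : bool * N.-tuple bool) : N.+1.-tuple bool := [tuple of p.1 :: p.2].
have h_bij : bijective h.
  exists (fun w : N.+1.-tuple bool => (thead w, [tuple of behead w])).
    by case=> b w; congr (_, _); apply: val_inj.
  by move=> w; rewrite [RHS]tuple_eta; exact: val_inj.
rewrite -!sum1_card (reindex h)/=; last exact: onW_bij.
rewrite -(pair_big_dep xpredT (fun b (w : N.-tuple bool) => Q (b :: w))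
  (fun _ _ => 1%N))/=.
by rewrite big_bool.
Qed.

Lemma coin_probS N Q : coin_prob N.+1 Q =
  (coin_prob N (fun w => Q (true :: w)) +
   coin_prob N (fun w => Q (false :: w))) / 2.
Proof.
rewrite /coin_prob card_tupleS natrD exprS invfM -mulrDl.
by rewrite [2^-1 * _]mulrC mulrA.
Qed.

Lemma coin_prob_ge0 N Q : 0 <= coin_prob N Q.
Proof. by rewrite divr_ge0// exprn_ge0. Qed.

Lemma coin_prob_le1 N Q : coin_prob N Q <= 1.
Proof.
rewrite ler_pdivrMr ?exprn_gt0// mul1r -natrX ler_nat.
by apply: leq_trans (max_card _) _; rewrite card_tuple card_bool.
Qed.

Lemma coin_prob_true N (Q : pred (seq bool)) :
  (forall w, Q w) -> coin_prob N Q = 1.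
Proof.
move=> QT; rewrite /coin_prob eq_cardT => [|w]; last by rewrite inE QT.
by rewrite -cardE card_tuple card_bool natrX divff// expf_neq0.
Qed.

Lemma eq_coin_prob N (Q1 Q2 : pred (seq bool)) :
  (forall w, Q1 w = Q2 w) -> coin_prob N Q1 = coin_prob N Q2.
Proof.
move=> e; rewrite /coin_prob; congr (_%:R / _); apply: eq_card => w.
by rewrite !inE e.
Qed.

End CoinWords.

Section Walk.
Variables (R : realType) (K : nat).

Definition walk_step (s : nat) (b : bool) : nat :=
  if (s == 0) || (s == K) then s else if b then s.+1 else s.-1.

Definition walk (s : nat) (w : seq bool) : nat := foldl walk_step s w.

Lemma walk_step_le s b : (s <= K)%N -> (walk_step s b <= K)%N.
Proof.
rewrite /walk_step => sK; case: ifPn => //; rewrite negb_or => /andP[s0 sK'].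
by case: b; [rewrite ltn_neqAle sK'|apply: leq_trans (leq_pred _) _].
Qed.

Lemma walk_le s w : (s <= K)%N -> (walk s w <= K)%N.
Proof. by elim: w s => //= b w ih s sK; apply/ih/walk_step_le. Qed.

Lemma walk_0 w : walk 0 w = 0.
Proof. by elim: w. Qed.

Lemma walk_K w : walk K w = K.
Proof. by elim: w => //= b w ih; rewrite /walk_step eqxx orbT ih. Qed.

(** The event that t is visited within n steps and the walk is at K after n steps; [fl] records an
    earlier visit. The recursion follows the first toss, as the inductions below do. *)
Fixpoint hits_then_top (t n s : nat) (fl : bool) (w : seq bool) : bool :=
  let fl' := fl || (s == t) in
  if n is n'.+1 then
    hits_then_top t n' (walk_step s (head false w)) fl' (behead w)
  else fl' && (s == K).

Lemma hits_then_topE t n s fl w : (n <= size w)%N ->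
  hits_then_top t n s fl w =
  (fl || [exists k : 'I_n.+1, walk s (take k w) == t]) &&
  (walk s (take n w) == K).
Proof.
elim: n s fl w => [|n ih] s fl w /=.
  move=> _; rewrite take0 /=; congr ((fl || _) && _).
  apply/idP/existsP => [/eqP <-|[k]]; first by exists ord0; rewrite take0.
  by rewrite ord1 take0.
case: w => // b w; rewrite /= ltnS => nw; rewrite ih//; congr (_ && _).
rewrite -orbA; congr (_ || _).
apply/orP/existsP => [[/eqP <-|/existsP[k kt]]|[k]].
- by exists ord0.
- by exists (lift ord0 k).
- case: (unliftP ord0 k) => [j ->|->] /= kt; last by left.
  by right; apply/existsP; exists j.
Qed.

(** The limit of these probabilities for s >= t: (K - s) / (K - t) is the chance to reach t before
    K, and t / K that of reaching K from t. *)
Definition hit_value (t s : nat) (fl : bool) : R :=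
  if fl then s%:R / K%:R else (K%:R - s%:R) * t%:R / ((K%:R - t%:R) * K%:R).

Lemma walk_coin_probS N n s fl t :
  s != 0%N -> s != K ->
  coin_prob R N.+1 (hits_then_top t n.+1 s fl) =
  (coin_prob R N (hits_then_top t n s.+1 (fl || (s == t))) +
   coin_prob R N (hits_then_top t n s.-1 (fl || (s == t)))) / 2.
Proof.
by move=> s0 sK; rewrite coin_probS /= /walk_step (negPf s0) (negPf sK).
Qed.

(* Gambler's ruin: the hitting probability is the harmonic function
   [hit_value]; stopping after n steps loses at most the expected absorption
   time s * (K - s) divided by n. *)
Lemma hits_then_top_lower t n N s fl :
  (0 < t < K)%N -> (s <= K)%N -> fl || (t <= s)%N -> (n <= N)%N ->
  n%:R * (hit_value t s fl - coin_prob R N (hits_then_top t n s fl)) <=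
  s%:R * (K%:R - s%:R).
Proof.
move=> /andP[t0 tK]; have K0 : (0 < K)%N by exact: ltn_trans tK.
have Kgt0 : 0 < K%:R :> R by rewrite ltr0n.
have Ktgt0 : 0 < K%:R - t%:R :> R by rewrite subr_gt0 ltr_nat.
have tgt0 : 0 < t%:R :> R by rewrite ltr0n.
elim: n N s fl => [|n ih] N s fl sK flts nN.
  by rewrite mul0r mulr_ge0// subr_ge0 ler_nat.
have pge0 := coin_prob_ge0 R N (hits_then_top t n.+1 s fl).
have n0 : 0 <= n.+1%:R :> R by [].
have [s0|s0] := eqVneq s 0%N.
  have flT : fl by move: flts; rewrite s0 leqNgt t0 orbF.
  by move: pge0; rewrite s0 flT mul0r /hit_value mul0r sub0r mulrN oppr_le0 => ?;
    rewrite mulr_ge0.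
have [sKe|sKn] := eqVneq s K.
  rewrite sKe subrr mulr0; case: fl flts pge0 => [_ _|_].
    rewrite coin_prob_true ?/hit_value ?divff ?subrr ?mulr0//.
      by rewrite pnatr_eq0 -lt0n.
    move=> w; elim: (n.+1) w => [|k ihk] w /=; first exact: eqxx.
    by rewrite /walk_step eqxx orbT.
  rewrite sKe /hit_value subrr !mul0r sub0r mulrN oppr_le0 => ?.
  by rewrite mulr_ge0.
case: N nN pge0 => // N; rewrite ltnS => nN _.
rewrite walk_coin_probS//.
set fl' := fl || _.
have s_pos : (0 < s)%N by rewrite lt0n.
have s1 : (s%:R = s.-1%:R + 1 :> R) by rewrite -{1}(prednK s_pos) natr1.
have s2 : (s.+1%:R = s%:R + 1 :> R) by rewrite natr1.
have sltK : (s < K)%N by rewrite ltn_neqAle sKn.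
(* At s = t the flag switches on, and both formulas give t / K there. *)
have harm : hit_value t s fl = (hit_value t s.+1 fl' + hit_value t s.-1 fl') / 2.
  rewrite /fl'; case: fl flts {fl'} => /= [_|ts].
    rewrite /hit_value s2 s1; field; exact: lt0r_neq0.
  have [<-|st] := eqVneq s t; rewrite /hit_value.
    by rewrite s2 s1; field; rewrite -s1 !lt0r_neq0// subr_gt0 ltr_nat.
  rewrite s2 s1; field.
  by rewrite !lt0r_neq0.
have i1 := ih N s.+1 fl' sltK _ nN.
have i2 := ih N s.-1 fl' _ _ nN.
have {}i1 : n%:R * (hit_value t s.+1 fl' -
    coin_prob R N (hits_then_top t n s.+1 fl')) <= s.+1%:R * (K%:R - s.+1%:R).
  apply: i1; rewrite /fl'; case: fl flts {i2 harm fl'} => //= ts.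
  by rewrite (leqW ts) orbT.
have {}i2 : n%:R * (hit_value t s.-1 fl' -
    coin_prob R N (hits_then_top t n s.-1 fl')) <= s.-1%:R * (K%:R - s.-1%:R).
  apply: i2; first by apply: leq_trans (leq_pred _) sK.
  rewrite /fl'; case: fl flts {i1 harm fl'} => //= ts.
  by case: eqVneq => //= st; rewrite -ltnS prednK// ltn_neqAle eq_sym st.
rewrite harm.
(* One more step adds at most 1 to the left side, while s (K - s) exceeds the mean of its two
   neighbours by exactly 1. *)
have gle1 : (hit_value t s.+1 fl' + hit_value t s.-1 fl') / 2 <= 1.
  rewrite -harm /hit_value; case: (fl) flts => /= [_|ts].
    by rewrite ler_pdivrMr// mul1r ler_nat.
  rewrite ler_pdivrMr ?mulr_gt0// mul1r ler_pM ?ler_nat//.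
  - by rewrite subr_ge0 ler_nat.
  - by rewrite lerB ?ler_nat.
  - exact: ltnW.
have p1 := coin_prob_ge0 R N (hits_then_top t n s.+1 fl').
have p2 := coin_prob_ge0 R N (hits_then_top t n s.-1 fl').
move: i1 i2 gle1 p1 p2; rewrite -[n.+1%:R]natr1 s2 s1.
move: (hit_value _ _ _) (hit_value _ _ _) (coin_prob _ _ _) (coin_prob _ _ _).
move=> a b c e; set z := s.-1%:R; set nn := n%:R => *.
lra.
Qed.

(** The function s / K is harmonic for the absorbed walk and dominates the indicator of K. *)
Lemma walk_top_upper n N s : (s <= K)%N -> (0 < K)%N -> (n <= N)%N ->
  coin_prob R N (fun w => walk s (take n w) == K) <= s%:R / K%:R.
Proof.
move=> sK K0; have Kgt0 : 0 < K%:R :> R by rewrite ltr0n.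
elim: n N s sK => [|n ih] N s sK nN.
  under eq_coin_prob do rewrite take0 /=.
  have [->|sKn] := eqVneq s K.
    by rewrite divff ?lt0r_neq0//; exact: coin_prob_le1.
  rewrite /coin_prob eq_card0 ?mul0r; first by rewrite divr_ge0.
  by move=> w; rewrite !inE.
case: N nN => // N; rewrite ltnS => nN.
rewrite coin_probS.
under eq_coin_prob do rewrite /=.
under [X in _ + X]eq_coin_prob do rewrite /=.
have [s0|s0] := eqVneq s 0%N.
  have := ih N s sK nN.
  rewrite s0 /walk_step eqxx/= => ?; lra.
have [sKe|sKn] := eqVneq s K.
  have := ih N s sK nN.
  by rewrite sKe /walk_step eqxx/= orbT => ?; lra.
rewrite /walk_step (negPf s0) (negPf sKn) /=.
have := ih N s.+1 _ nN; rewrite ltn_neqAle sKn sK => /(_ isT).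
have := ih N s.-1 (leq_trans (leq_pred _) sK) nN.
have s_pos : (0 < s)%N by rewrite lt0n.
have s1 : (s%:R = s.-1%:R + 1 :> R) by rewrite -{1}(prednK s_pos) natr1.
rewrite -[s.+1%:R]natr1 s1 !mulrDl => *.
lra.
Qed.

End Walk.

(** * Matching paths *)

Section Matchings.

Lemma zip_mem (T U : eqType) (s : seq T) (t : seq U) p :
  p \in zip s t -> p.1 \in s /\ p.2 \in t.
Proof.
elim: s t => [|x s ih] [|y t]//=; rewrite inE => /predU1P[->|/ih[ps pt]].
  by split; exact: mem_head.
by split; apply/orP; right.
Qed.

Lemma perm_eq_enum (T : finType) (l : seq T) :
  uniq l -> size l = #|T| -> perm_eq l (enum T).
Proof.
move=> ul sl; apply: uniq_perm => //; first exact: enum_uniq.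
have sub : {subset l <= enum T} by move=> x _; rewrite mem_enum.
by have [|_] := uniq_min_size ul sub; first by rewrite -cardE sl.
Qed.

(* Pairing the elements of P left over by the partial matching with those of Q,
   and the complement of P with what is left of the complement of Q, extends a
   partial matching of large enough size to a full one. *)
Lemma extend_matching (Z I : finType) (P Q : pred Z) (f g : I -> Z) :
  injective f -> injective g -> (forall i, P (f i)) -> (forall i, ~~ Q (g i)) ->
  (#|Q| <= #|P|)%N -> (#|P| <= #|Q| + #|I|)%N ->
  exists l : seq (Z * Z),
    [/\ perm_eq (unzip1 l) (enum Z), perm_eq (unzip2 l) (enum Z) &
        forall p, p \in l -> P p.1 = Q p.2 \/ exists i, p = (f i, g i)].
Proof.
move=> fI gI Pf Qg QP PQ.
pose nP : pred Z := fun z => ~~ P z.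
pose nQ : pred Z := fun z => ~~ Q z.
(* Keeping exactly |P| - |Q| of the given pairs leaves |Q| elements of P and, outside Q, as many
   elements as the complement of P has. *)
pose J := take (#|P| - #|Q|) (enum I).
have sJ : size J = (#|P| - #|Q|)%N.
  by rewrite size_takel// -cardE leq_subLR.
have uJ : uniq J by rewrite take_uniq ?enum_uniq.
pose r1 := [seq z <- enum P | z \notin map f J].
pose r2 := [seq z <- enum nQ | z \notin map g J].
have ufJ : uniq (map f J) by rewrite map_inj_uniq.
have ugJ : uniq (map g J) by rewrite map_inj_uniq.
have size_r (A : pred Z) (h : I -> Z) : injective h -> (forall i, A (h i)) ->
    (size [seq z <- enum A | z \notin map h J] + size J)%N = #|A|.
  move=> hI Ah; rewrite [#|A|]cardE -(size_map h J) size_filter.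
  rewrite -[RHS](count_predC (fun z => z \notin map h J)); congr (_ + _)%N.
  rewrite -size_filter; apply: perm_size; apply: uniq_perm.
  - by rewrite map_inj_uniq.
  - by rewrite filter_uniq// enum_uniq.
  - move=> z; rewrite mem_filter /= negbK mem_enum.
    case zJ: (z \in map h J) => //=; case/mapP: zJ => i _ ->.
    by rewrite -topredE /= Ah.
have s1 : size r1 = #|Q|.
  by have := size_r P f fI Pf; rewrite sJ -/r1; lia.
have cQ : (#|Q| + #|nQ|)%N = #|Z| by exact: cardC.
have cP : (#|P| + #|nP|)%N = #|Z| by exact: cardC.
have s2 : size r2 = #|nP|.
  by have := size_r nQ g gI Qg; rewrite sJ -/r2; lia.
exists ([seq (f i, g i) | i <- J] ++ zip r1 (enum Q) ++ zip (enum nP) r2).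
split.
- rewrite /unzip1 !map_cat -map_comp -/(unzip1 _) -/(unzip1 _) !unzip1_zip;
    last first.
  + by rewrite s1 cardE.
  + by rewrite s2 cardE.
  apply: perm_eq_enum; last by rewrite !size_cat size_map sJ s1 -cardE; lia.
  rewrite !cat_uniq ufJ filter_uniq ?enum_uniq//= andbT; apply/andP; split.
    apply/hasPn => z; rewrite mem_cat mem_filter mem_enum => /orP[/andP[]//|].
    rewrite mem_enum => nPz; apply/negP => /mapP[i _ zi].
    by move: nPz; rewrite zi -topredE /= /nP Pf.
  apply/hasPn => z; rewrite !mem_enum /r1 mem_filter mem_enum => nPz.
  by rewrite negb_and; apply/orP; right; exact: nPz.
- rewrite /unzip2 !map_cat -map_comp -/(unzip2 _) -/(unzip2 _) !unzip2_zip;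
    last first.
  + by rewrite s1 cardE.
  + by rewrite s2 cardE.
  apply: perm_eq_enum; last by rewrite !size_cat size_map sJ s2 -cardE; lia.
  rewrite !cat_uniq ugJ enum_uniq filter_uniq ?enum_uniq//=; apply/andP; split.
    apply/hasPn => z; rewrite mem_cat mem_enum mem_filter.
    move=> /orP[|/andP[]//] Qz; apply/negP => /mapP[i _ zi].
    by have /negP := Qg i; apply; rewrite zi in Qz.
  rewrite andbT; apply/hasPn => z; rewrite /r2 mem_filter mem_enum => /andP[_ nQz].
  by rewrite mem_enum.
- move=> p; rewrite !mem_cat => /or3P[/mapP[i _ ->]|/zip_mem|/zip_mem].
  + by right; exists i.
  + rewrite mem_enum /r1 mem_filter mem_enum => -[/andP[_ Pp] Qp]; left.
    by move: Pp Qp; rewrite -!topredE /= => -> ->.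
  + rewrite mem_enum /r2 mem_filter mem_enum => -[Pp /andP[_ Qp]]; left.
    by move: Pp Qp; rewrite -!topredE /= => /negPf -> /negPf ->.
Qed.

(** All entries from position i on exceed t, so only the first i can be at most t. *)
Lemma count_sorted_le (T : eqType) (f : T -> nat) (s : seq T) x0 i t :
  sorted (fun x y => (f x <= f y)%N) s -> (t < f (nth x0 s i))%N ->
  (i < size s)%N ->
  (count (fun x => f x <= t) s <= i)%N.
Proof.
move=> ss ti si.
rewrite -(cat_take_drop i s) count_cat [X in (_ + X)%N](_ : _ = 0)%N.
  by rewrite addn0; apply: leq_trans (count_size _ _) _; rewrite size_take si.
apply/eqP; rewrite -leqn0 leqNgt -has_count -all_predC; apply/allP => x.
move=> /(nthP x0)[j]; rewrite size_drop nth_drop => js <- /=; rewrite -ltnNge.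
apply: leq_trans ti _.
have tr : transitive (fun x y => (f x <= f y)%N).
  by move=> ? ? ?; exact: leq_trans.
have refl_f : reflexive (fun x y => (f x <= f y)%N) by move=> ?; exact: leqnn.
apply: (sorted_leq_nth tr refl_f x0 ss); rewrite ?inE//; lia.
Qed.

(* Matches the i-th smallest value of f with the (q - 1 - i)-th smallest. *)
Lemma antitone_matching (T : finType) (A : pred T) (f : T -> nat) (K q : nat) :
  (q <= #|A|)%N -> (forall x, A x -> (f x <= K)%N) ->
  (forall t, (t < K)%N ->
    (q <= #|[pred x | A x & (f x <= t)%N]| +
          #|[pred x | A x & (f x <= K.-1 - t)%N]|)%N) ->
  exists2 l : seq (T * T),
    [/\ size l = q, uniq (unzip1 l) & uniq (unzip2 l)] &
    forall p, p \in l -> [/\ A p.1, A p.2 & (f p.1 + f p.2 <= K)%N].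
Proof.
move=> qA fK cond.
pose leF x y := (f x <= f y)%N.
pose s := sort leF (enum A).
have ps : perm_eq s (enum A) by rewrite perm_sort.
have ss : sorted leF s by apply: sort_sorted => x y; exact: leq_total.
have szs : size s = #|A| by rewrite (perm_size ps) cardE.
have cnt t : count (fun x => (f x <= t)%N) s = #|[pred x | A x & (f x <= t)%N]|.
  rewrite (permP ps) -size_filter cardE; apply: perm_size; apply: uniq_perm.
  - by rewrite filter_uniq// enum_uniq.
  - exact: enum_uniq.
  - by move=> x; rewrite mem_filter !mem_enum !inE andbC.
have szt : size (take q s) = q by rewrite size_takel ?szs.
have us : uniq (take q s) by rewrite take_uniq// (perm_uniq ps) enum_uniq.
exists (zip (take q s) (rev (take q s))).
  rewrite size_zip unzip1_zip ?unzip2_zip ?size_rev// szt minnn rev_uniq us.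
  by split.
move=> p pin.
have inA x : x \in take q s -> A x.
  by move=> /mem_take; rewrite (perm_mem ps) mem_enum.
have [p1 p2] := zip_mem pin; rewrite mem_rev in p2.
split; [exact: inA|exact: inA|].
have [i] := nthP p pin; rewrite size_zip size_rev szt minnn => iq.
case: p pin p1 p2 => x y pin p1 p2.
rewrite nth_zip ?size_rev// => -[xE yE] /=.
(* Otherwise, for t = f x - 1, at most i values are <= t and at most q - 1 - i are <= K - 1 - t,
   fewer than q together. *)
rewrite leqNgt; apply/negP => Klt.
have fxK : (f x <= K)%N by exact: fK (inA _ p1).
have fyK : (f y <= K)%N by exact: fK (inA _ p2).
have fx0 : (0 < f x)%N by lia.
rewrite nth_rev szt// nth_take in yE; last lia.
rewrite nth_take// in xE.
have c1 : (count (fun z => (f z <= (f x).-1)%N) s <= i)%N.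
  by apply: (@count_sorted_le _ f s x) => //; rewrite ?xE ?szs; lia.
have c2 : (count (fun z => (f z <= K.-1 - (f x).-1)%N) s <= q - i.+1)%N.
  by apply: (@count_sorted_le _ f s y) => //; rewrite ?yE ?szs; lia.
have tK : ((f x).-1 < K)%N by lia.
have := cond _ tK; rewrite -!cnt => qle.
have := leq_trans qle (leq_add c1 c2); lia.
Qed.

End Matchings.

(** * Pairs of walk paths with a common level *)

Section PathMatching.
Variable K : nat.
Local Notation walk := (walk K).

(** Discrete intermediate value property: a step changes the level by at most one. *)
Lemma walk_between k s w V :
  (minn s (walk s (take k w)) <= V <= maxn s (walk s (take k w)))%N ->
  exists2 j, (j <= k)%N & walk s (take j w) = V.
Proof.
elim: k s w => [|k ih] s [|b w] /=; rewrite ?minnn ?maxnn => VE.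
- by exists 0%N => //=; lia.
- by exists 0%N => //=; lia.
- by exists 0%N => //=; lia.
have [sV|sV] := eqVneq s V; first by exists 0%N.
have [|j jk jV] := ih (walk_step K s b) w; last by exists j.+1.
move: VE; rewrite /walk_step; case: ifPn => // _; case: b; lia.
Qed.

Lemma walk_reflect s w : (s <= K)%N ->
  walk (K - s) (map negb w) = (K - walk s w)%N.
Proof.
elim: w s => //= b w ih s sK.
rewrite -ih ?walk_step_le//; congr (walk _ _).
rewrite /walk_step; have [->|s0] := eqVneq s 0%N.
  by rewrite subn0 eqxx orbT.
have [->|sKn] := eqVneq s K; first by rewrite subnn.
by case: b => /=; case: ifP; lia.
Qed.

Variables (H : nat) (s : nat).

Definition lowest (w : seq bool) : nat :=
  walk s (take [arg min_(k < ord0 : 'I_H.+1) walk s (take k w)]%N w).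

Lemma lowest_le (w : seq bool) k : (k <= H)%N -> (lowest w <= walk s (take k w))%N.
Proof.
rewrite /lowest; case: arg_minnP => // i _ imin kH.
by have := imin (inord k) isT; rewrite inordK.
Qed.

Lemma lowest_visited (w : seq bool) :
  exists2 k, (k <= H)%N & walk s (take k w) = lowest w.
Proof.
by rewrite /lowest; set k := arg_min _ _ _; exists k => //; rewrite -ltnS.
Qed.

Lemma lowest_le_start w : (lowest w <= s)%N.
Proof. by have := @lowest_le w 0 (leq0n _); rewrite take0. Qed.

Definition reaches_top (w : seq bool) := walk s (take H w) == K.

(** A path that visits t has its minimum at or below t; this turns the ruin estimate into a count of
    low paths. *)
Lemma card_hits_then_top N t : (H <= N)%N ->
  (#|[pred w : N.-tuple bool | hits_then_top K t H s false w]| <=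
   #|[pred w : N.-tuple bool | reaches_top w & (lowest w <= t)%N]|)%N.
Proof.
move=> HN; apply/subset_leq_card/fintype.subsetP => w.
rewrite -!topredE /= hits_then_topE ?size_tuple//= => /andP[/existsP[k /eqP kt]].
move=> top; rewrite /reaches_top top /= -kt; apply: lowest_le.
by rewrite -ltnS.
Qed.

(* The second path is reflected, so that a low point of it becomes a high
   point. *)
Lemma path_matching N q : (H <= N)%N -> (s <= K)%N -> (K - s <= s)%N ->
  (q <= #|[pred w : N.-tuple bool | reaches_top w]|)%N ->
  (forall t, (t < K)%N ->
    (q <= #|[pred w : N.-tuple bool | reaches_top w & (lowest w <= t)%N]| +
      #|[pred w : N.-tuple bool | reaches_top w & (lowest w <= K.-1 - t)%N]|)%N) ->
  exists a b : 'I_q -> N.-tuple bool,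
    [/\ injective a, injective b,
        forall i, walk s (take H (a i)) = K,
        forall i, walk (K - s) (take H (b i)) = 0%N &
        forall i, exists d e, [/\ (d <= H)%N, (e <= H)%N &
          walk s (take d (a i)) = walk (K - s) (take e (b i))]].
Proof.
move=> HN sK Ks qtop qcond.
have lowK (w : N.-tuple bool) : reaches_top w -> (lowest w <= K)%N.
  by move=> _; apply: leq_trans (lowest_le_start _) sK.
have [l [sl ul1 ul2] lP] := antitone_matching qtop lowK qcond.
have [q0|q0] := posnP q.
  exists (fun=> [tuple of nseq N true]), (fun=> [tuple of nseq N true]).
  by split; try (move=> [i iq]; move: (iq); rewrite q0).
have [x0 x0l] : exists x, x \in l.
  by case: (l) sl q0 => [<-|x l' _ _] //; exists x; rewrite mem_head.
pose flip (w : N.-tuple bool) : N.-tuple bool := [tuple of map negb w].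
have flipK : involutive flip.
  move=> w; apply: val_inj.
  by rewrite /= -map_comp map_id_in// => b _ /=; rewrite negbK.
have nthl (i : 'I_q) : nth x0 l i \in l by rewrite mem_nth// sl.
exists (fun i => (nth x0 l i).1), (fun i => flip (nth x0 l i).2).
have refl k (w : N.-tuple bool) :
    walk (K - s) (take k (flip w)) = (K - walk s (take k w))%N.
  by rewrite -map_take walk_reflect.
have top (i : 'I_q) : walk s (take H (nth x0 l i).1) = K.
  by have [/eqP] := lP _ (nthl i).
split => //.
- move=> i j /eqP; rewrite -!(nth_map x0 x0.1)?sl// nth_uniq ?size_map ?sl//.
  by move=> /eqP/val_inj.
- move=> i j /(inv_inj flipK) /eqP.
  rewrite -!(nth_map x0 x0.2)?sl// nth_uniq ?size_map ?sl//.
  by move=> /eqP/val_inj.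
- move=> i; rewrite refl; have [_ /eqP -> _] := lP _ (nthl i).
  by rewrite subnn.
- move=> i; have [_ _ low12] := lP _ (nthl i).
  set w := (nth x0 l i).1 in low12 *; set w' := (nth x0 l i).2 in low12 *.
  have [k kH kE] := lowest_visited w; have [k' k'H k'E] := lowest_visited w'.
  have lw := lowest_le_start w; have lw' := lowest_le_start w'.
  have arith a a' : (a <= s)%N -> (a' <= s)%N -> (a + a' <= K)%N ->
      (minn (K - s) (K - a') <= maxn a (K - s) <= maxn (K - s) (K - a'))%N by lia.
  (* The first path descends from s >= K - s to [lowest w]; the reflected one climbs from K - s to K
     - [lowest w'], which is at least [lowest w] by the matching. Both cross V. *)
  pose V := maxn (lowest w) (K - s)%N.
  have [|d dk dV] := @walk_between k s w V.
    by rewrite kE /V geq_min leq_maxl orbT /= leq_max geq_max lw Ks /=.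
  have [|e ek eV] := @walk_between k' (K - s)%N (flip w') V.
    by rewrite refl k'E; apply: arith.
  exists d, e; split; [exact: leq_trans kH|exact: leq_trans k'H|].
  by rewrite dV eV.
Qed.

End PathMatching.

(** * Markov chains on a finite sample space *)

Section UniformMeasure.
Variables (R : realType) (M : nat).

(** The uniform law on {0, ..., M}, carried by nat, where every set is measurable. *)
Definition uniform_below : set nat -> \bar R :=
  mscale (M.+1%:R^-1)%:nng (msum (fun i => dirac i) M.+1).

HB.instance Definition _ := Measure.on uniform_below.

Lemma uniform_belowE (A : set nat) :
  uniform_below A = (M.+1%:R^-1 * \sum_(i < M.+1) (\1_A (i : nat) : R))%:E.
Proof.
rewrite /uniform_below /mscale /msum /= EFinM; congr (_ * _)%E.
by rewrite -sumEFin.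
Qed.

Lemma uniform_below_setT : uniform_below setT = 1%E.
Proof.
rewrite uniform_belowE (eq_bigr (fun=> 1)) => [|i _].
  by rewrite sumr_const card_ord mulVf.
by rewrite indicE in_setT.
Qed.

HB.instance Definition _ :=
  Measure_isProbability.Build _ _ R uniform_below uniform_below_setT.

End UniformMeasure.

Section FiniteChain.
Variables (R : realType) (S Z : finType) (P : S -> S -> R).
Hypothesis P_tm : transition_matrix P.
Variable X : nat -> Z -> S.
Hypothesis X_count : forall n (A : pred Z) s',
  (forall z z', (forall k, (k <= n)%N -> X k z = X k z') -> A z = A z') ->
  \sum_z (A z && (X n.+1 z == s'))%:R =
  \sum_s P s s' * \sum_z (A z && (X n z == s))%:R :> R.

Variables (M : nat) (l : seq Z) (z0 : Z).
Hypothesis lZ : perm_eq l (enum Z).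
Hypothesis lM : size l = M.+1.

Let Pr := uniform_below R M.
Let Y n i := X n (nth z0 l i).

Let l_uniq : uniq l. Proof. by rewrite (perm_uniq lZ) enum_uniq. Qed.

Let l_mem z : z \in l. Proof. by rewrite (perm_mem lZ) mem_enum. Qed.

Lemma uniform_below_list (B : set nat) (Q : pred Z) :
  (forall i, (i <= M)%N -> B i <-> Q (nth z0 l i)) ->
  Pr B = (M.+1%:R^-1 * \sum_z (Q z)%:R)%:E.
Proof.
move=> BQ; rewrite /Pr uniform_belowE; congr (_ * _)%:E.
rewrite -(big_mkord xpredT (fun i => \1_B i)) /=.
rewrite -[in RHS]big_enum/= -(perm_big _ lZ)/= (big_nth z0) lM.
rewrite big_nat [RHS]big_nat; apply: eq_bigr => i /andP[_ iM].
rewrite indicE; congr ((nat_of_bool _)%:R); rewrite ltnS in iM.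
have [Q1 Q2] := BQ i iM.
by apply/idP/idP; [rewrite inE => /Q1|move=> /Q2; rewrite inE].
Qed.

(** An event of the natural filtration depends only on the path so far, so [X_count] applies to its
    image in Z. The order of l is free: two enumerations of Z give two copies of the chain on one
    space. *)
Lemma finite_markov_chain : markov_chain P Pr Y.
Proof.
split=> // n t A FA.
have Ainv : forall i j, (forall k, (k <= n)%N -> Y k i = Y k j) -> A i <-> A j.
  (* The sets that do not separate indices with equal paths up to time n form a sigma-algebra
     containing the generators. *)
  suff : natural_filtration Y n `<=`
      [set B | forall i j, (forall k, (k <= n)%N -> Y k i = Y k j) -> B i <-> B j].
    exact.
  apply: smallest_sub.
    split.
    - by move=> i j _.
    - by move=> B Binv i j ij; rewrite setTD; split => nB /(Binv i j ij).
    - move=> F Finv i j ij.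
      by split => -[k _ Fk]; exists k => //; apply/(Finv k i j ij).
  by move=> B [k kn [C _ <-]] i j ij; rewrite setTI /= (ij k).
pose Q z := `[< A (index z l) >].
have AQ i : (i <= M)%N -> A i <-> Q (nth z0 l i).
  move=> iM; rewrite /Q index_uniq// ?lM//.
  by split=> [Ai|/asboolP//]; apply/asboolP.
have Qinv z z' : (forall k, (k <= n)%N -> X k z = X k z') -> Q z = Q z'.
  move=> zz'; apply: asbool_equiv_eq; apply: Ainv => k kn.
  by rewrite /Y !nth_index//; exact: zz'.
rewrite (@integral_finite_valued _ _ _ _ Pr A (Y n) (fun s => P s t)) //;
  last by move=> s; exact: P_tm.1.
rewrite [LHS](uniform_below_list
  (Q := fun z => Q z && (X n.+1 z == t))); last first.
  move=> i iM; split => [[/(AQ i iM) -> /eqP] //|/andP[/(AQ i iM) Ai /eqP]].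
  by split.
rewrite X_count// mulr_sumr; congr (_%:E); apply: eq_bigr => s _.
rewrite mulrCA; congr (_ * _).
rewrite [X in fine X](uniform_below_list (Q := fun z => Q z && (X n z == s)))//.
move=> i iM; split => [[/(AQ i iM) -> /eqP] //|/andP[/(AQ i iM) Ai /eqP]].
by split.
Qed.

End FiniteChain.

(** * The lazy walk *)

Section UniformImage.
Variables (R : realType) (S : finType).

(** The law of h(u) for uniform u; every row of the lazy walk's matrix has this form. *)
Definition uniform_image (U : finType) (h : U -> S) (s : S) : R :=
  (\sum_u (h u == s)%:R) / #|U|%:R.

Lemma uniform_image_ge0 (U : finType) (h : U -> S) s : 0 <= uniform_image h s.
Proof. by rewrite divr_ge0// sumr_ge0. Qed.

Lemma uniform_image_sum (U : finType) (h : U -> S) : (0 < #|U|)%N ->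
  \sum_s uniform_image h s = 1.
Proof.
move=> U0; rewrite -mulr_suml exchange_big/= (eq_bigr (fun=> 1)) => [|u _].
  by rewrite sumr_const mulfV// pnatr_eq0 -lt0n.
by rewrite (bigD1 (h u))//= eqxx big1 ?addr0// => s /negPf; rewrite eq_sym => ->.
Qed.

(* [cur z] is a coordinate of z that can be replaced by u, giving [res u z];
   an event B not depending on it is independent of it. *)
Lemma resample_coordinate (Z U : finType) (B : pred Z) (cur : Z -> U)
    (res : U -> Z -> Z) (h : U -> S) s : (0 < #|U|)%N ->
  (forall u z, B (res u z) = B z) -> (forall u z, cur (res u z) = u) ->
  (forall u z, res (cur z) (res u z) = z) ->
  \sum_z (B z && (h (cur z) == s))%:R = uniform_image h s * \sum_z (B z)%:R.
Proof.
move=> U0 Bres curres resres.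
have Un0 : #|U|%:R != 0 :> R by rewrite pnatr_eq0 -lt0n.
apply: (mulIf Un0); rewrite /uniform_image mulrAC divfK//.
(* Exchanging the coordinate of z with a fresh u is an involution, hence preserves the count of
   pairs. *)
pose swap (p : U * Z) := (cur p.2, res p.1 p.2).
have swapK : cancel swap swap by case=> u z; rewrite /swap /= curres resres.
transitivity (\sum_(p : U * Z) (B p.2 && (h (cur p.2) == s))%:R : R).
  rewrite -(pair_big xpredT xpredT
    (fun _ z => (B z && (h (cur z) == s))%:R : R))/=.
  by rewrite sumr_const mulr_natr.
rewrite (reindex swap)/=; last exact: onW_bij (Bijective swapK swapK).
under eq_bigr => p _ do rewrite Bres curres.
rewrite -(pair_big xpredT xpredT (fun u z => (B z && (h u == s))%:R : R))/=.
rewrite mulr_suml; apply: eq_bigr => u _.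
rewrite mulr_sumr; apply: eq_bigr => z _.
by rewrite -natrM mulnb andbC.
Qed.

End UniformImage.

Section LazyWalk.
Variables (R : realType) (K N T : nat).

(* Clock, number of steps to wait before moving, level. *)
Local Notation lw_state := ('I_N.+3 * 'I_T.+1 * 'I_K.+1)%type.

Definition lw_mk (c t l : nat) : lw_state := (inord c, inord t, inord l).

(** Identifies all final levels other than K, so that samples agreeing on whether they end at K
    finish in the same state. *)
Definition lw_merge (l : nat) : nat := if l == K then K else 0%N.

(** Clock 0 draws the waiting time, clocks 1 to N wait or walk, clock N + 1 merges levels, clock N +
    2 is absorbing. Keeping the clock in the state makes the chain time-homogeneous. *)
Definition lw_matrix (s : lw_state) : lw_state -> R :=
  let: (c, t, l) := s in
  if c == 0%N :> nat then
    uniform_image R (fun t' : 'I_T.+1 => lw_mk 1 t' l)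
  else if (c <= N)%N then
    if t == 0%N :> nat then
      uniform_image R (fun b : bool => lw_mk c.+1 0 (walk_step K l b))
    else uniform_image R (fun _ : unit => lw_mk c.+1 t.-1 l)
  else if c == N.+1 :> nat then
    uniform_image R (fun _ : unit => lw_mk N.+2 0 (lw_merge l))
  else uniform_image R (fun _ : unit => s).

Lemma lw_matrix_tm : transition_matrix lw_matrix.
Proof.
split=> [s t|s]; rewrite /lw_matrix; case: s => [[c t'] l].
  by do 4?case: ifP => _; exact: uniform_image_ge0.
by do 4?case: ifP => _; rewrite uniform_image_sum ?card_ord ?card_bool ?card_unit.
Qed.

(* A sample: the waiting time, and the moves counted from the end of it. *)
Local Notation lw_sample := ('I_T.+1 * N.-tuple bool)%type.

Definition lw_level (s : nat) (z : lw_sample) (j : nat) : nat :=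
  walk K s (take (j - z.1) z.2).

(** At time j + 1 only j steps have been spent on waiting and walking, since the first draws the
    waiting time. Truncated subtraction covers both phases. *)
Definition lw_path (s n : nat) (z : lw_sample) : lw_state :=
  if n is j.+1 then
    if (j <= N)%N then lw_mk n (z.1 - j) (lw_level s z j)
    else lw_mk N.+2 0 (lw_merge (lw_level s z N))
  else lw_mk 0 0 s.

Lemma lw_level_le s z j : (s <= K)%N -> (lw_level s z j <= K)%N.
Proof. exact: walk_le. Qed.

Lemma lw_mk_inj c t l c' t' l' :
  (c <= N.+2)%N -> (t <= T)%N -> (l <= K)%N ->
  (c' <= N.+2)%N -> (t' <= T)%N -> (l' <= K)%N ->
  lw_mk c t l = lw_mk c' t' l' -> [/\ c = c', t = t' & l = l'].
Proof.
move=> cN tT lK cN' tT' lK' [/(congr1 val) + /(congr1 val) + /(congr1 val)].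
by rewrite /= !inordK.
Qed.

Lemma lw_matrix_start l : (l <= K)%N ->
  lw_matrix (lw_mk 0 0 l) = uniform_image R (fun t' : 'I_T.+1 => lw_mk 1 t' l).
Proof. by move=> lK; rewrite /lw_matrix /lw_mk !inordK. Qed.

Lemma lw_matrix_wait j t l : (j < N)%N -> (t < T)%N -> (l <= K)%N ->
  lw_matrix (lw_mk j.+1 t.+1 l) =
  uniform_image R (fun _ : unit => lw_mk j.+2 t l).
Proof.
by move=> jN tT lK; rewrite /lw_matrix {1}/lw_mk !inordK//= ?jN//; lia.
Qed.

Lemma lw_matrix_walk j l : (j < N)%N -> (l <= K)%N ->
  lw_matrix (lw_mk j.+1 0 l) =
  uniform_image R (fun b : bool => lw_mk j.+2 0 (walk_step K l b)).
Proof.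
by move=> jN lK; rewrite /lw_matrix {1}/lw_mk !inordK//= ?jN//; lia.
Qed.

Lemma lw_matrix_merge t l : (t <= T)%N -> (l <= K)%N ->
  lw_matrix (lw_mk N.+1 t l) =
  uniform_image R (fun _ : unit => lw_mk N.+2 0 (lw_merge l)).
Proof. by move=> tT lK; rewrite /lw_matrix {1}/lw_mk !inordK//= ltnn eqxx. Qed.

Lemma lw_matrix_end t l : (t <= T)%N -> (l <= K)%N ->
  lw_matrix (lw_mk N.+2 t l) =
  uniform_image R (fun _ : unit => lw_mk N.+2 t l).
Proof.
move=> tT lK; rewrite /lw_matrix {1}/lw_mk !inordK//= ltnNge leqnSn /=.
by rewrite eqn_leq ltnn.
Qed.

(** Once the wait is over, i - z.1 is the index of the toss used between times i + 1 and i + 2; the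
    path up to time i + 1 is not affected. *)
Definition lw_res (i : nat) (b : bool) (z : lw_sample) : lw_sample :=
  (z.1, [tuple if (k == i - z.1 :> nat)%N then b else tnth z.2 k | k < N]).

Lemma lw_res_nth i b (z : lw_sample) j : (j < N)%N ->
  nth false (lw_res i b z).2 j = if j == (i - z.1)%N then b else nth false z.2 j.
Proof.
move=> jN; rewrite -[j]/(nat_of_ord (Ordinal jN)) -tnth_nth tnth_mktuple/=.
by rewrite (tnth_nth false).
Qed.

Lemma lw_res_take i b (z : lw_sample) j : (j <= i)%N ->
  take (j - z.1) (lw_res i b z).2 = take (j - z.1) z.2.
Proof.
move=> ji; apply: (@eq_from_nth _ false); first by rewrite !size_take !size_tuple.
move=> k; rewrite size_take size_tuple => kj.
have kj' : (k < j - z.1)%N by move: kj; case: ifP => //; lia.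
have kN : (k < N)%N by move: kj; case: ifP => //; lia.
by rewrite !nth_take// lw_res_nth//; case: eqP => //; lia.
Qed.

Lemma lw_path_res s i b z n : (n <= i.+1)%N ->
  lw_path s n (lw_res i b z) = lw_path s n z.
Proof.
case: n => // j; rewrite ltnS => ji.
rewrite /lw_path /lw_level -[(lw_res i b z).1]/(z.1).
case: ifP => jN; first by rewrite lw_res_take.
have Ni : (N <= i)%N by lia.
by rewrite lw_res_take.
Qed.

Lemma lw_path_frozen s n z : (N.+2 <= n)%N -> lw_path s n z = lw_path s N.+2 z.
Proof.
case: n => // j; rewrite ltnS => Nj; rewrite /lw_path ltnn.
by rewrite leqNgt Nj.
Qed.

Lemma lw_count s n (A : pred lw_sample) s' : (s <= K)%N ->
  (forall z z', (forall k, (k <= n)%N -> lw_path s k z = lw_path s k z') ->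
    A z = A z') ->
  \sum_z (A z && (lw_path s n.+1 z == s'))%:R =
  \sum_r lw_matrix r s' * \sum_z (A z && (lw_path s n z == r))%:R :> R.
Proof.
move=> sK Ainv.
rewrite (eq_bigr (fun z => \sum_r
    ((A z && (lw_path s n z == r)) && (lw_path s n.+1 z == s'))%:R)); last first.
  move=> z _; rewrite (bigD1 (lw_path s n z))//= eqxx andbT big1 ?addr0// => r.
  by rewrite eq_sym => /negPf ->; rewrite andbF.
rewrite exchange_big/=; apply: eq_bigr => r _.
pose B z := A z && (lw_path s n z == r).
have unit_case (h : unit -> lw_state) :
    (forall z, B z -> lw_path s n.+1 z = h tt) ->
    \sum_z (B z && (lw_path s n.+1 z == s'))%:R =
    uniform_image R h s' * \sum_z (B z)%:R :> R.
  move=> hB; rewrite -(@resample_coordinate R _ _ _ B (fun=> tt) (fun _ z => z))//.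
  - apply: eq_bigr => z _; case Bz : (B z) => //.
    by rewrite hB.
  - by rewrite card_unit.
  - by move=> [].
(* An unattained r contributes 0 to both sides; otherwise a sample [z0] in state r determines the
   phase. *)
have [z0 /andP[_ /eqP z0r]|noB] := pickP B; last first.
  rewrite !big1 ?mulr0// => z _; have := noB z; rewrite /B => -> //.
case: n Ainv @B unit_case z0r => [|j] Ainv B unit_case z0r.
  have -> : lw_matrix r = uniform_image R (fun t' : 'I_T.+1 => lw_mk 1 t' s).
    by rewrite -z0r lw_matrix_start.
  rewrite -(@resample_coordinate R _ _ _ B (fun z => z.1) (fun u z => (u, z.2)))//.
  - by apply: eq_bigr => z _; rewrite /lw_path /lw_level subn0 take0.
  - by rewrite card_ord.
  - move=> u z; rewrite /B; congr (_ && _).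
    by apply: Ainv => k; rewrite leqn0 => /eqP ->.
  - by move=> u [].
have BE z : B z -> lw_path s j.+1 z = lw_path s j.+1 z0.
  by move=> /andP[_ /eqP ->].
have [Nj|jN] := ltnP N j.
  have -> : lw_matrix r = uniform_image R (fun _ : unit => r).
    rewrite -z0r lw_path_frozen// /lw_path ltnn lw_matrix_end//.
    by rewrite /lw_merge; case: ifP.
  apply: unit_case => z /BE; rewrite z0r => <-.
  by rewrite lw_path_frozen ?[RHS]lw_path_frozen//; lia.
pose t0 := (z0.1 - j)%N; pose l0 := lw_level s z0 j.
have zT (z : lw_sample) i : (z.1 - i <= T)%N.
  by apply: leq_trans (leq_subr _ _) _; rewrite -ltnS.
have {z0r}rE : r = lw_mk j.+1 t0 l0 by rewrite -z0r /lw_path jN.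
have {}BE z : B z -> (z.1 - j)%N = t0 /\ lw_level s z j = l0.
  move=> /BE; rewrite /lw_path jN => /lw_mk_inj[]//; rewrite ?lw_level_le//; lia.
have l0K : (l0 <= K)%N by exact: lw_level_le.
have [jeN|jneN] := eqVneq j N.
  have -> : lw_matrix r =
      uniform_image R (fun _ : unit => lw_mk N.+2 0 (lw_merge l0)).
    by rewrite rE jeN lw_matrix_merge//; exact: zT.
  apply: unit_case => z /BE[_ <-].
  by rewrite /lw_path jeN ltnn.
have {jneN}jN' : (j < N)%N by rewrite ltn_neqAle jneN.
have [t00|t0n] := eqVneq t0 0%N; last first.
  have -> : lw_matrix r = uniform_image R (fun _ : unit => lw_mk j.+2 t0.-1 l0).
    rewrite rE -{1}(prednK (n := t0)) ?lt0n// lw_matrix_wait//.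
    by have := zT z0 j; rewrite -/t0; lia.
  apply: unit_case => z /BE[tz lz]; rewrite /lw_path jN'.
  congr lw_mk; first by rewrite subnS tz.
  rewrite -lz /lw_level; congr (walk _ _ (take _ _)); lia.
have -> : lw_matrix r =
    uniform_image R (fun b : bool => lw_mk j.+2 0 (walk_step K l0 b)).
  by rewrite rE t00 lw_matrix_walk.
rewrite -(@resample_coordinate R _ _ _ B
  (fun z => nth false z.2 (j - z.1)) (fun b z => lw_res j b z)).
- apply: eq_bigr => z _; rewrite -/(B z); case Bz : (B z) => //.
  have [tz <-] := BE z Bz; rewrite /lw_path jN'.
  have -> : (z.1 - j.+1)%N = 0%N by lia.
  rewrite /lw_level subSn; last by lia.
  rewrite (take_nth false) ?size_tuple; last by lia.
  by rewrite /walk -cats1 foldl_cat.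
- by rewrite card_bool.
- move=> b z; rewrite /B lw_path_res//; congr (_ && _).
  by apply: Ainv => k kj; rewrite lw_path_res//.
- by move=> b z; rewrite lw_res_nth ?eqxx//; lia.
- move=> b [t w]; congr (_, _); apply: eq_from_tnth => k.
  rewrite tnth_mktuple (tnth_nth false) lw_res_nth//=.
  by rewrite (tnth_nth false); case: eqP => [->|].
Qed.

End LazyWalk.

Section Laws.
Variables (R : realType) (S : finType) (P : S -> S -> R).
Hypothesis P_tm : transition_matrix P.

Lemma step_lawS n x y :
  step_law P n.+1 x y = \sum_z P x z * step_law P n z y.
Proof. by []. Qed.

Lemma step_lawSr n x y :
  step_law P n.+1 x y = \sum_z step_law P n x z * P z y.
Proof.
elim: n x => [|n ih] x.
  rewrite /= (bigD1 y)//= eqxx mulr1 big1 ?addr0 => [|z /negPf ->]; last first.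
    by rewrite mulr0.
  rewrite (bigD1 x)//= eqxx mul1r big1 ?addr0// => z.
  by rewrite eq_sym => /negPf ->; rewrite mul0r.
rewrite [LHS]step_lawS; under eq_bigr => z _ do rewrite ih mulr_sumr.
rewrite exchange_big/=; apply: eq_bigr => z _.
by rewrite mulr_suml; apply: eq_bigr => z' _; rewrite mulrA.
Qed.

(** Lets matrix powers be computed by counting samples of a realised chain. *)
Lemma markov_chain_law (d : measure_display) (Omega : measurableType d)
    (Pr : probability Omega R) (X : nat -> Omega -> S) (x : S) n t :
  markov_chain P Pr X -> {ae Pr, forall w, X 0%N w = x} ->
  fine (Pr (X n @^-1` [set t])) = step_law P n x t.
Proof.
move=> XM X0.
(* Stated for all g, since the induction replaces g by P g. *)
suff H (g : S -> R) : \sum_s g s * fine (Pr (X n @^-1` [set s])) =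
    \sum_s step_law P n x s * g s.
  have := H (fun s => (s == t)%:R).
  rewrite (bigD1 t)//= eqxx mul1r big1 ?addr0 => [->|s /negPf ->]; last first.
    by rewrite mul0r.
  rewrite (bigD1 t)//= eqxx mulr1 big1 ?addr0// => s /negPf ->.
  by rewrite mulr0.
elim: n g => [|n ih] g.
  rewrite (sum_initial_law XM X0) (bigD1 x)//= eqxx mul1r big1 ?addr0// => s.
  by rewrite eq_sym => /negPf ->; rewrite mul0r.
have FT : natural_filtration X n setT by exact: natural_filtrationT.
under eq_bigr do rewrite -[X _ @^-1` _]setTI.
rewrite (markov_step P_tm XM g FT).
under eq_bigr do rewrite setTI.
rewrite ih.
under [RHS]eq_bigr do rewrite step_lawSr mulr_suml.
rewrite [RHS]exchange_big/=; apply: eq_bigr => s _.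
by rewrite mulr_sumr; apply: eq_bigr => z _; rewrite mulrA.
Qed.

End Laws.

Lemma uniform_below_eq1 (R : realType) M (A : set nat) :
  (forall i, (i <= M)%N -> A i) -> uniform_below R M A = 1%E.
Proof.
move=> AM; rewrite uniform_belowE (eq_bigr (fun=> 1)) => [|i _].
  by rewrite sumr_const card_ord mulVf.
by rewrite indicE mem_set//; apply: AM; rewrite -ltnS.
Qed.

(** * Coupling two lazy walks *)

Section LazyWalkCoupling.
Variables (R : realType) (K N T H s q : nat).
Hypotheses (K0 : (0 < K)%N) (sK : (s <= K)%N) (TH : (H <= T)%N)
  (TN : (T.+1 + H <= N)%N).
Local Notation Z := ('I_T.+1 * N.-tuple bool)%type.
Local Notation P := (@lw_matrix R K N T).
Local Notation mk := (lw_mk K N T).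

Definition ends_at_top (r : nat) (z : Z) := lw_level K r z N == K.

Lemma walk_take_stays (r c : nat) w n : (c == 0%N) || (c == K) ->
  walk K r (take H w) = c -> (H <= n)%N -> walk K r (take n w) = c.
Proof.
move=> c0K rc Hn; rewrite -(subnKC Hn) takeD /walk foldl_cat -/(walk K r _) rc.
by case/orP: c0K => /eqP ->; [exact: walk_0|exact: walk_K].
Qed.

Variables (a b : 'I_q -> N.-tuple bool).
Hypotheses (aI : injective a) (bI : injective b).
Hypothesis a_top : forall i, walk K s (take H (a i)) = K.
Hypothesis b_bot : forall i, walk K (K - s) (take H (b i)) = 0%N.
Hypothesis ab_meet : forall i, exists d e, [/\ (d <= H)%N, (e <= H)%N &
  walk K s (take d (a i)) = walk K (K - s) (take e (b i))].
Hypothesis QP : (#|ends_at_top (K - s)| <= #|ends_at_top s|)%N.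
Hypothesis PQ :
  (#|ends_at_top s| <= #|ends_at_top (K - s)| + (T.+1 - H) * q)%N.

(** Each copy waits for the other's travel time in addition to r, so both arrive after r + d + e
    steps with no wait remaining; r < T + 1 - H keeps both waits within T. *)
Lemma lw_path_meet (r d e : nat) (w w' : N.-tuple bool) :
  (r < T.+1 - H)%N -> (d <= H)%N -> (e <= H)%N ->
  walk K s (take d w) = walk K (K - s) (take e w') ->
  lw_path K s (r + d + e).+1 (inord (r + e) : 'I_T.+1, w) =
  lw_path K (K - s) (r + d + e).+1 (inord (r + d) : 'I_T.+1, w').
Proof.
move=> rT dH eH dE; have jN : (r + d + e <= N)%N by lia.
rewrite /lw_path jN.
rewrite /lw_level /= !inordK; [|lia..].
have -> : (r + e - (r + d + e) = 0)%N by lia.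
have -> : (r + d - (r + d + e) = 0)%N by lia.
have -> : (r + d + e - (r + e) = d)%N by lia.
have -> : (r + d + e - (r + d) = e)%N by lia.
by rewrite dE.
Qed.

(** Matched words with shifted waits form (T + 1 - H) q meeting pairs. All other pairs agree on
    [ends_at_top] and meet in the merged state at time N + 2. *)
Lemma sample_matching : exists l : seq (Z * Z),
  [/\ perm_eq (unzip1 l) (enum {: Z}), perm_eq (unzip2 l) (enum {: Z}) &
      forall p, p \in l -> exists n, lw_path K s n p.1 = lw_path K (K - s) n p.2].
Proof.
have /choice[de deP] : forall i, exists de : nat * nat,
    [/\ (de.1 <= H)%N, (de.2 <= H)%N &
        walk K s (take de.1 (a i)) = walk K (K - s) (take de.2 (b i))].
  by move=> i; have [d [e ?]] := ab_meet i; exists (d, e).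
pose f (p : 'I_(T.+1 - H) * 'I_q) : Z := (inord (p.1 + (de p.2).2), a p.2).
pose g (p : 'I_(T.+1 - H) * 'I_q) : Z := (inord (p.1 + (de p.2).1), b p.2).
have fI : injective f.
  move=> [r i] [r' i'] fg.
  have ii' : i = i' by apply: aI; exact: (congr1 snd fg).
  move: (congr1 (fun z : Z => z.1 : nat) fg); rewrite /=.
  have [_ e1 _] := deP i; have [_ e2 _] := deP i'.
  rewrite !inordK; [|have := ltn_ord r; have := ltn_ord r'; lia..].
  rewrite ii' => /addIn rr'; congr (_, _); exact: val_inj.
have gI : injective g.
  move=> [r i] [r' i'] fg.
  have ii' : i = i' by apply: bI; exact: (congr1 snd fg).
  move: (congr1 (fun z : Z => z.1 : nat) fg); rewrite /=.
  have [d1 _ _] := deP i; have [d2 _ _] := deP i'.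
  rewrite !inordK; [|have := ltn_ord r; have := ltn_ord r'; lia..].
  rewrite ii' => /addIn rr'; congr (_, _); exact: val_inj.
(* Even the longest wait leaves H moves, so the first H tosses decide the end of these paths. *)
have HN (u : 'I_T.+1) : (H <= N - u)%N by have := ltn_ord u; lia.
have Pf p : ends_at_top s (f p).
  apply/eqP/walk_take_stays; [by rewrite eqxx orbT|exact: a_top|].
  exact: HN.
have Qg p : ~~ ends_at_top (K - s) (g p).
  rewrite /ends_at_top /lw_level (@walk_take_stays _ 0)//.
    by rewrite eq_sym -lt0n.
  exact: b_bot.
have cI : (#|ends_at_top s| <=
    #|ends_at_top (K - s)| + #|{: 'I_(T.+1 - H) * 'I_q}|)%N.
  by rewrite card_prod !card_ord.
have [l [l1 l2 lP]] := extend_matching fI gI Pf Qg QP cI.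
exists l; split => //.
move=> p /lP[e|[[r i] ->]].
  by exists N.+2; rewrite /lw_path ltnn /lw_merge -/(ends_at_top _ _) e.
have [dH eH dE] := deP i.
by exists (r + (de i).1 + (de i).2).+1; exact: lw_path_meet.
Qed.

(** The sample space is the set of positions in the list of pairs; either coordinate of the list
    enumerates all samples, so both marginals are correct. *)
Lemma lazy_walk_coupled : can_be_coupled_to_meet P (mk 0 0 s) (mk 0 0 (K - s)).
Proof.
have [l [l1 l2 lP]] := sample_matching.
have P_tm : transition_matrix P by exact: lw_matrix_tm.
have l_size : size l = (size l).-1.+1.
  rewrite prednK// -(size_map fst) (perm_size l1) -cardE card_prod card_ord.
  by rewrite card_tuple card_bool muln_gt0 expn_gt0.
pose M := (size l).-1.
pose z0 : Z := (ord0, [tuple of nseq N true]).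
pose X n i := lw_path K s n (nth z0 (unzip1 l) i).
pose Y n i := lw_path K (K - s) n (nth z0 (unzip2 l) i).
exists _, _, (uniform_below R M), X, Y; split.
  split.
  - apply: (finite_markov_chain P_tm) l1 _; last by rewrite size_map.
    by move=> n A s' Ainv; exact: lw_count.
  - apply: (finite_markov_chain P_tm) l2 _; last by rewrite size_map.
    by move=> n A s' Ainv; apply: lw_count => //; exact: leq_subr.
  - exact: aeW.
  - exact: aeW.
rewrite meeting_time_finite; apply: uniform_below_eq1 => i iM.
have il : (i < size l)%N by rewrite l_size ltnS.
have [n XYn] := lP _ (mem_nth (z0, z0) il).
exists n => //; exists n => //.
by rewrite /X /Y (nth_map (z0, z0))// XYn (nth_map (z0, z0)).
Qed.

Lemma step_law_lw r n t (rK : (r <= K)%N) :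
  step_law P n (mk 0 0 r) t =
  (#|{: Z}|%:R^-1 * \sum_(z : Z) (lw_path K r n z == t)%:R).
Proof.
have P_tm : transition_matrix P by exact: lw_matrix_tm.
have Z0 : (0 < #|{: Z}|)%N.
  by rewrite card_prod card_ord card_tuple card_bool muln_gt0 expn_gt0.
pose z0 : Z := (ord0, [tuple of nseq N true]).
pose X n i := lw_path K r n (nth z0 (enum {: Z}) i).
have sZ : size (enum {: Z}) = #|{: Z}|.-1.+1 by rewrite -cardE prednK.
have XM : markov_chain P (uniform_below R #|{: Z}|.-1) X.
  apply: (finite_markov_chain P_tm) (perm_refl _) sZ.
  by move=> m A s' Ainv; exact: lw_count.
rewrite -(markov_chain_law P_tm n t XM (x := mk 0 0 r)); last exact: aeW.
rewrite [X in fine X](@uniform_below_list _ _ _ _ z0 (perm_refl _) sZ _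
  (fun z => lw_path K r n z == t)).
  by rewrite /= prednK.
by move=> i iM; split => [/eqP|/eqP].
Qed.

(** The laws are constant from time N + 2 on, and the merged state at K serves as test set. *)
Lemma limiting_tv_dist_lw :
  (#|ends_at_top s|%:R - #|ends_at_top (K - s)|%:R) / #|{: Z}|%:R <=
  limiting_tv_dist P (mk 0 0 s) (mk 0 0 (K - s)).
Proof.
have KsK : (K - s <= K)%N by exact: leq_subr.
pose u n := tv_dist (step_law P n (mk 0 0 s)) (step_law P n (mk 0 0 (K - s))).
have step_frozen r n : (r <= K)%N -> (N.+2 <= n)%N ->
    step_law P n (mk 0 0 r) = step_law P N.+2 (mk 0 0 r).
  move=> rK Nn; apply/funext => t; rewrite !step_law_lw//.
  by congr (_ * _); apply: eq_bigr => z _; rewrite lw_path_frozen.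
have -> : limiting_tv_dist P (mk 0 0 s) (mk 0 0 (K - s)) = u N.+2.
  apply: cvg_lim => //; apply: cvg_near_cst.
  by exists N.+2 => // n /= Nn; rewrite !step_frozen.
have top r : (r <= K)%N -> step_law P N.+2 (mk 0 0 r) (mk N.+2 0 K) =
    #|ends_at_top r|%:R / #|{: Z}|%:R.
  move=> rK; rewrite step_law_lw// mulrC; congr (_ / _).
  rewrite -sum1_card natr_sum [RHS]big_mkcond/=; apply: eq_bigr => z _.
  rewrite -[z \in _]/(lw_level K r z N == K) /lw_path ltnn /lw_merge.
  have lK := lw_level_le z N rK.
  have [_|lnK] := eqVneq (lw_level K r z N) K; first by rewrite eqxx.
  case: eqP => // /lw_mk_inj[]// _ _ KE.
  by move: K0; rewrite -KE.
rewrite mulrBl -!top//; apply: le_trans (ler_norm _) _.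
have := le_tv_dist (step_law P N.+2 (mk 0 0 s)) (step_law P N.+2 (mk 0 0 (K - s)))
  [set mk N.+2 0 K]%SET.
by rewrite !big_set1.
Qed.

End LazyWalkCoupling.

(** * Choice of the parameters *)

Section Counting.
Variables (R : realType) (K N H : nat).
Hypotheses (K1 : (1 < K)%N) (H0 : (0 < H)%N).

(** Bounds the truncation error s (K - s) / n for n >= H. *)
Let e : R := K%:R ^+ 2 / H%:R.

Lemma hits_then_top_ge t n s fl :
  (0 < t < K)%N -> (s <= K)%N -> fl || (t <= s)%N -> (H <= n <= N)%N ->
  hit_value R K t s fl - e <= coin_prob R N (hits_then_top K t n s fl).
Proof.
move=> tK sK flt /andP[Hn nN].
have := hits_then_top_lower R tK sK flt nN.
set g := hit_value _ _ _ _ _; set p := coin_prob _ _ _ => le_sK.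
have n0 : 0 < n%:R :> R by rewrite ltr0n; exact: leq_trans Hn.
have H0' : 0 < H%:R :> R by rewrite ltr0n.
suff : g - p <= e by lra.
have sR : s%:R <= K%:R :> R by rewrite ler_nat.
have sR0 : 0 <= s%:R :> R by [].
apply: le_trans (_ : K%:R ^+ 2 / n%:R <= _).
  rewrite ler_pdivlMr// mulrC; apply: le_trans le_sK _; nra.
by rewrite ler_wpM2l ?exprn_ge0// lef_pV2 ?posrE// ler_nat.
Qed.

Lemma walk_top_lower n s : (s <= K)%N -> (H <= n <= N)%N ->
  s%:R / K%:R - e <= coin_prob R N (fun w => walk K s (take n w) == K).
Proof.
move=> sK Hn.
(* With the flag set only the end at K is tested; t = 1 is an arbitrary level strictly between 0 and
   K. *)
have -> : coin_prob R N (fun w => walk K s (take n w) == K) =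
    coin_prob R N (hits_then_top K 1 n s true).
  rewrite /coin_prob; congr (_%:R / _); apply: eq_card => w.
  rewrite !inE hits_then_topE//= size_tuple.
  by case/andP: Hn.
rewrite -[s%:R / K%:R]/(hit_value R K 1 s true).
by apply: hits_then_top_ge => //; rewrite K1.
Qed.

Lemma card_coin_prob (Q : pred (seq bool)) :
  #|[pred w : N.-tuple bool | Q w]|%:R = coin_prob R N Q * 2 ^+ N.
Proof. by rewrite /coin_prob divfK// expf_neq0. Qed.

(** Samples are sorted by their waiting time t, which leaves N - t moves. *)
Lemma card_ends_at_top T r :
  #|@ends_at_top K N T r|%:R =
  \sum_(t < T.+1) coin_prob R N (fun w => walk K r (take (N - t) w) == K) * 2 ^+ N.
Proof.
under eq_bigr do rewrite -card_coin_prob.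
rewrite -natr_sum -sum1_card.
under [in RHS]eq_bigr do rewrite -sum1_card.
by rewrite pair_big_dep.
Qed.

Lemma card_ends_at_top_le T r : (r <= K)%N ->
  #|@ends_at_top K N T r|%:R <= T.+1%:R * 2 ^+ N * (r%:R / K%:R) :> R.
Proof.
move=> rK; rewrite card_ends_at_top.
apply: le_trans (_ : \sum_(t < T.+1) (r%:R / K%:R) * 2 ^+ N <= _).
  apply: ler_sum => t _; rewrite ler_pM2r ?exprn_gt0//.
  by apply: walk_top_upper => //; [exact: ltnW|exact: leq_subr].
by rewrite sumr_const card_ord -[_ *+ T.+1]mulr_natl mulrA mulrAC.
Qed.

Lemma card_ends_at_top_ge T r : (r <= K)%N -> (T + H <= N)%N ->
  T.+1%:R * 2 ^+ N * (r%:R / K%:R - e) <= #|@ends_at_top K N T r|%:R :> R.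
Proof.
move=> rK TN; rewrite card_ends_at_top.
apply: le_trans (_ : _ <= \sum_(t < T.+1) (r%:R / K%:R - e) * 2 ^+ N) _.
  by rewrite sumr_const card_ord -[X in _ <= X]mulr_natl [X in _ <= X]mulrA mulrAC.
apply: ler_sum => t _; rewrite ler_pM2r ?exprn_gt0//.
apply: walk_top_lower => //; rewrite leq_subr andbT.
by have := ltn_ord t; lia.
Qed.

End Counting.

(** With c = k, u = t + 1 and v = K - t, the right side adds the ruin values for the levels t and K
    - 1 - t. *)
Lemma paired_ruin_inequality (F : realFieldType) (c u v : F) :
  2 <= c -> u + v = 4 * c + 1 -> c + 2 <= u -> c + 2 <= v ->
  1 / 2 <= (c + 1) * (u - 1) / (v * (4 * c)) + (c + 1) * (v - 1) / (u * (4 * c)).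
Proof.
move=> c2 uvE u_ge v_ge.
have [u0 v0] : 0 < u /\ 0 < v by split; lra.
rewrite -subr_ge0.
have -> : (c + 1) * (u - 1) / (v * (4 * c)) + (c + 1) * (v - 1) / (u * (4 * c)) -
    1 / 2 =
  ((c + 1) * (u ^+ 2 + v ^+ 2 - (u + v)) - 2 * c * (u * v)) / (4 * c * (u * v)).
  by field; rewrite !gt_eqF//; lra.
apply: divr_ge0; last by rewrite !mulr_ge0//; lra.
(* The numerator is the sum of these three terms. *)
have : 0 <= (c + 1) * (u - v) ^+ 2 by rewrite mulr_ge0 ?sqr_ge0//; lra.
have : 0 <= u * (v - (c + 1)) by rewrite mulr_ge0//; lra.
have : 0 <= v * (u - (c + 1)) by rewrite mulr_ge0//; lra.
nra.
Qed.

(** * Explicit parameters with limiting distance near one half *)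

Section NumericalChoice.
Variables (R : realType) (k : nat).
Hypothesis k2 : (2 <= k)%N.

(** H makes the truncation error e = 1 / (3 K). The fraction of waiting times lost to shifts is H /
    (T + 1) = 1 / K = 3 e, and N leaves at least H moves after any wait. *)
Let K := (4 * k)%N.
Let s := (3 * k - 1)%N.
Let H := (3 * K ^ 3)%N.
Let T := (H * K).-1.
Let N := (H * K + H)%N.
Let e : R := K%:R ^+ 2 / H%:R.

Let K_gt1 : (1 < K)%N. Proof. by rewrite /K; lia. Qed.
Let H_gt0 : (0 < H)%N. Proof. by rewrite /H muln_gt0 expn_gt0; lia. Qed.
Let T1 : T.+1 = (H * K)%N. Proof. by rewrite /T prednK// muln_gt0 H_gt0; lia. Qed.
Let sK : (s <= K)%N. Proof. by rewrite /s /K; lia. Qed.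
Let Ks : (K - s)%N = k.+1. Proof. by rewrite /s /K; lia. Qed.

Let k0 : 2 <= k%:R :> R. Proof. by rewrite ler_nat. Qed.
Let k_gt0 : 0 < k%:R :> R. Proof. by rewrite ltr0n; apply: leq_trans k2. Qed.
Let KE : K%:R = 4 * k%:R :> R. Proof. by rewrite natrM. Qed.
Let sE : s%:R = 3 * k%:R - 1 :> R.
Proof. by rewrite /s natrB ?natrM//; lia. Qed.

Let eE : e = (12 * k%:R)^-1.
Proof.
rewrite /e /H natrM natrX KE; field.
by rewrite gt_eqF//; exact: k_gt0.
Qed.

Let sKE : s%:R / K%:R = 3 / 4 - 3 * e.
Proof. by rewrite eE sE KE; field; rewrite gt_eqF//; exact: k_gt0. Qed.

Let KsKE : (K - s)%:R / K%:R = 1 / 4 + 3 * e.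
Proof. by rewrite Ks -natr1 eE KE; field; rewrite gt_eqF//; exact: k_gt0. Qed.

Let e_gt0 : 0 < e. Proof. by rewrite eE invr_gt0 mulr_gt0. Qed.
Let e_le : e <= 1 / 24.
Proof.
rewrite eE -[1 / 24]invrK lef_pV2 ?posrE ?mulr_gt0//; have := k0; lra.
Qed.

Let D t := #|[pred w : N.-tuple bool | reaches_top K H s w &
                                       (lowest K H s w <= t)%N]|.
Let G := #|[pred w : N.-tuple bool | reaches_top K H s w]|.

Let HN : (H <= H <= N)%N. Proof. by rewrite leqnn leq_addl. Qed.

Let G_ge : (1 / 2 - 2 * e) * 2 ^+ N <= G%:R :> R.
Proof.
rewrite /G (@card_coin_prob R N (fun w => reaches_top K H s w)).
rewrite ler_pM2r ?exprn_gt0//.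
have := walk_top_lower R K_gt1 H_gt0 sK HN; rewrite -/e sKE.
have := e_le; lra.
Qed.

(** If one of the two levels is at least s, every path ending at K counts, as its minimum is at most
    s. Otherwise the two ruin values add up to at least 1/2, with an error e each. *)
Let DD_ge t : (t < K)%N ->
  (1 / 2 - 2 * e) * 2 ^+ N <= (D t + D (K.-1 - t))%:R :> R.
Proof.
have D_top j : (s <= j)%N -> D j = G.
  move=> sj; apply: eq_card => w; rewrite !inE.
  by rewrite (leq_trans (lowest_le_start K H s w) sj) andbT.
move=> tK; have [st|ts] := leqP s t.
  rewrite (D_top t st) natrD; apply: le_trans G_ge _.
  by rewrite lerDl.
have [st|ts'] := leqP s (K.-1 - t)%N.
  rewrite (D_top _ st) natrD; apply: le_trans G_ge _.
  by rewrite lerDr.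
have Dge j : (0 < j < s)%N -> (hit_value R K j s false - e) * 2 ^+ N <= (D j)%:R.
  move=> /andP[j0 js].
  apply: le_trans (_ : #|[pred w : N.-tuple bool |
      hits_then_top K j H s false w]|%:R <= _); last first.
    by rewrite ler_nat; apply: card_hits_then_top; case/andP: HN.
  rewrite (@card_coin_prob R) ler_pM2r ?exprn_gt0//.
  apply: hits_then_top_ge => //; last by rewrite /= ltnW.
  by rewrite j0 (leq_trans js).
have t0 : (0 < t)%N by move: ts'; rewrite /s /K; lia.
have t0' : (0 < K.-1 - t)%N by move: ts; rewrite /s /K; lia.
have h1 := Dge t; rewrite t0 ts in h1; have {}h1 := h1 isT.
have h2 := Dge (K.-1 - t)%N; rewrite t0' ts' in h2; have {}h2 := h2 isT.
rewrite natrD; apply: le_trans (lerD h1 h2).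
rewrite -mulrDl ler_pM2r ?exprn_gt0//.
suff : 1 / 2 <= hit_value R K t s false + hit_value R K (K.-1 - t) s false by lra.
have u1 : (k.+2 <= t.+1)%N by move: ts'; rewrite /s /K; lia.
have v1 : (k.+2 <= K - t)%N by move: ts; rewrite /s /K; lia.
pose u : R := t.+1%:R; pose v : R := (K - t)%:R.
have uvE : u + v = 4 * k%:R + 1.
  by rewrite /u /v natrB ?(ltnW tK)// -natr1 KE; lra.
have u_ge : k%:R + 2 <= u by rewrite -natrD ler_nat addn2.
have v_ge : k%:R + 2 <= v by rewrite -natrD ler_nat addn2.
have -> : hit_value R K t s false = (k%:R + 1) * (u - 1) / (v * (4 * k%:R)).
  rewrite /hit_value KE sE; congr (_ * _ / (_ * _)); first by lra.
    by rewrite /u -natr1 addrK.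
  by rewrite /v natrB ?(ltnW tK)// KE.
have vE : (K.-1 - t)%:R = v - 1.
  by rewrite /v (_ : K - t = (K.-1 - t).+1)%N -?natr1 ?addrK//; lia.
have -> : hit_value R K (K.-1 - t) s false =
    (k%:R + 1) * (v - 1) / (u * (4 * k%:R)).
  rewrite /hit_value vE KE sE; congr (_ * _ / (_ * _)); lra.
exact: paired_ruin_inequality.
Qed.

Let p r := #|@ends_at_top K N T r|.

Let TN : (T + H <= N)%N. Proof. by rewrite /T /N; lia. Qed.

Let KsK : (K - s <= K)%N. Proof. exact: leq_subr. Qed.

Let Zc : R := T.+1%:R * 2 ^+ N.

Let Zc_gt0 : 0 < Zc. Proof. by rewrite mulr_gt0// exprn_gt0. Qed.

Let p_le r : (r <= K)%N -> (p r)%:R <= Zc * (r%:R / K%:R).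
Proof. exact: card_ends_at_top_le. Qed.

Let p_ge r : (r <= K)%N -> Zc * (r%:R / K%:R - e) <= (p r)%:R.
Proof. by move=> rK; apply: card_ends_at_top_ge. Qed.

(** Starting at k + 1 instead of k lowers the difference of the two ending probabilities to 1/2 - 6
    e. This slack pays for the truncation errors and the lost waiting times. *)
Let excess_le c : (1 / 2 - 2 * e) * 2 ^+ N <= c%:R ->
  (p s <= p (K - s) + (T.+1 - H) * c)%N.
Proof.
move=> c_ge; rewrite -(ler_nat R) natrD natrM.
have hs := p_le sK; rewrite sKE in hs.
have hKs := p_ge KsK; rewrite KsKE in hKs.
have TH0 : 0 <= (T.+1 - H)%:R :> R by [].
suff : Zc * (1 / 2 - 5 * e) <=
    (T.+1 - H)%:R * ((1 / 2 - 2 * e) * 2 ^+ N).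
  have := ler_wpM2l TH0 c_ge; lra.
rewrite /Zc natrB; last by rewrite T1 leq_pmulr// ltnW.
rewrite T1 natrM mulrA mulrAC -subr_ge0 -mulrBl mulr_ge0 ?exprn_ge0//.
have Ke : K%:R * e = 1 / 3.
  by rewrite KE eE; field; rewrite gt_eqF//; exact: k_gt0.
have -> : (H%:R * K%:R - H%:R) * (1 / 2 - 2 * e) - H%:R * K%:R * (1 / 2 - 5 * e) =
  H%:R * (3 * (K%:R * e) - 1 / 2 + 2 * e) :> R by ring.
by rewrite Ke mulr_ge0//; have := e_gt0; lra.
Qed.

Lemma almost_half_example : exists (S : finType) (P : S -> S -> R) (x y : S),
  [/\ transition_matrix P, can_be_coupled_to_meet P x y &
      1 / 2 - k%:R^-1 <= limiting_tv_dist P x y].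
Proof.
have hs := p_ge sK; rewrite sKE in hs.
have hKs := p_le KsK; rewrite KsKE in hKs.
have Ksp : (p (K - s) <= p s)%N.
  rewrite -(ler_nat R); apply: le_trans hKs _; apply: le_trans hs.
  by rewrite ler_pM2l//; have := e_le; lra.
have exq : exists q, (p s <= p (K - s) + (T.+1 - H) * q)%N.
  exists G; exact: excess_le G_ge.
(* The least q covering the excess is bounded by every c allowed in [excess_le], which yields all
   counting conditions of the path matching. *)
case: (ex_minnP exq) => q PQ q_min.
have Kss : (K - s <= s)%N by rewrite Ks /s; lia.
have [a [b [aI bI a_top b_bot ab_meet]]] :=
  @path_matching K H s N q (leq_addl _ _) sK Kss (q_min _ (excess_le G_ge))
    (fun t tK => q_min _ (excess_le (DD_ge tK))).
exists ('I_N.+3 * 'I_T.+1 * 'I_K.+1)%type, (@lw_matrix R K N T).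
exists (lw_mk K N T 0 0 s), (lw_mk K N T 0 0 (K - s)).
split; first exact: lw_matrix_tm.
  apply: (lazy_walk_coupled R (H := H) _ _ _ _ aI bI a_top b_bot ab_meet Ksp PQ).
  - exact: ltnW.
  - exact: sK.
  - by rewrite -ltnS T1 ltn_Pmulr.
  - by rewrite T1.
apply: le_trans (limiting_tv_dist_lw R N T _ sK); last exact: ltnW.
rewrite card_prod card_ord card_tuple card_bool natrM natrX -/Zc.
rewrite ler_pdivlMr//.
apply: le_trans (lerB hs hKs).
(* The bounds 3/4 - 4 e and 1/4 + 3 e differ by 1/2 - 7 e, while 1 / k = 12 e. *)
suff : Zc * (1 / 2 - 7 * e) >= (1 / 2 - k%:R^-1) * Zc by lra.
rewrite mulrC ler_pM2l//.
have -> : k%:R^-1 = 12 * e by rewrite eE; field; rewrite gt_eqF//; exact: k_gt0.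
by have := e_gt0; lra.
Qed.

End NumericalChoice.

(** * The supremum from the two bounds *)

Theorem theorem6p1 (R : realType) : kappa R = 1 / 2%:R.
Proof.
rewrite /kappa; set A := [set v : R | _].
have A_le v : A v -> v <= 1 / 2.
  by move=> [S [P [x [y [P_tm PXY ->]]]]]; exact: limiting_tv_dist_le.
have A_ge k : (2 <= k)%N -> exists2 v, A v & 1 / 2 - k%:R^-1 <= v.
  move=> /(almost_half_example R)[S [P [x [y [P_tm PXY tv]]]]].
  by exists (limiting_tv_dist P x y) => //; exists S, P, x, y.
have [v0 Av0 _] := A_ge 2 (leqnn 2).
apply/eqP; rewrite eq_le; apply/andP; split.
  by apply: ge_sup => //; exists v0.
apply/ler_addgt0Pr => eps eps0.
have [k k_gt] : exists k : nat, eps^-1 < k%:R.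
  by exists (Num.bound eps^-1); rewrite archi_boundP// invr_ge0 ltW.
(* The shift by 2 meets the requirement 2 <= k of the examples. *)
have [v Av] := A_ge k.+2 isT.
have v_le : v <= sup A by apply: ub_le_sup => //; exists (1 / 2) => w /A_le.
have : k.+2%:R^-1 < eps.
  rewrite invf_plt ?posrE//; apply: lt_le_trans k_gt _.
  by rewrite ler_nat; lia.
move: (k.+2%:R^-1) => r; lra.
Qed.
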